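(* Let $1\le p<\infty$. The following identity holds: $$\mathbf{D}_a\mathbf{T}_au=\mathbf{T}_{\frac1a}Du\qquad\forall u\in W^{2,p}(-\ell,\ell).$$
   Context: Let $\ell>0$, $I=(-\ell,\ell)$, and let $a\in W^{1,\infty}(-\ell,\ell)$ be positive with $a,\frac1a\in L^2(-\ell,\ell)$ and $a(0)=1$. Write $D=\frac{d}{dx}$ and $\mathbf{D}_au:=a^2u'$. For $\rho\in\mathbb{C}$, $e_a(\rho,\cdot)$ denotes the unique solution of $-\frac1{a^2}(a^2u')'=\rho^2u$ on $I$ with $u(0)=1$, $(a^2u')(0)=i\rho$. It is known that there is a kernel $K_a\in W^{1,\infty}(\Omega)$, $\Omega=(-\ell,\ell)\times(-\ell,\ell)$, such that $e_a(\rho,x)=e^{i\rho x}-i\rho\int_{-x}^{x}K_a(x,t)e^{i\rho t}\,dt$ for all $x\in[-\ell,\ell]$, $\rho\in\mathbb{C}$, and $K_a(x,x)=1-\frac1{a(x)}$, $K_a(x,-x)=0$ for $x\in[-\ell,\ell]$. (The representation determines $K_a$ on $|t|\le|x|$.) The operator $\mathbf{T}_a$ is $\mathbf{T}_au(x):=u(x)-\int_{-x}^xK_a(x,t)u'(t)\,dt$, $-\ell\le x\le\ell$, for $u\in W^{1,p}(-\ell,\ell)$. For $x<0$, $\int_{-x}^x$ is the oriented integral. The function $\frac1a$ satisfies the same assumptions as $a$; $K_{1/a}$ and $\mathbf{T}_{1/a}$ are the corresponding kernel and operator with $a$ replaced by $\frac1a$. *)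

(* Defs.v *)
From HB Require Import structures.
From mathcomp Require Import all_boot all_order all_algebra.
From mathcomp Require Import complex.
From mathcomp Require Import all_classical all_reals all_analysis.
Set Implicit Arguments.
Unset Strict Implicit.
Unset Printing Implicit Defensive.
Import Order.TTheory GRing.Theory Num.Theory.
Import numFieldNormedType.Exports.
Local Open Scope classical_set_scope.
Local Open Scope ring_scope.

Section TestFunctions.
Context {R : realType} {V : normedModType R}.

Definition iter_derive (vs : seq V) (phi : V -> R) : V -> R :=
  foldr (fun v f => fun x => 'D_v f x) phi vs.

(* In finite dimension this is C^oo: all iterated directional derivatives
   exist and are continuous. *)
Definition smooth (phi : V -> R) : Prop :=
  forall vs : seq V, continuous (iter_derive vs phi) /\
    forall x v, derivable (iter_derive vs phi) x v.

Definition test_function (D : set V) (phi : V -> R) : Prop :=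
  [/\ smooth phi, compact (closure [set x | phi x != 0]) &
      closure [set x | phi x != 0] `<=` D].

End TestFunctions.

Section LebesgueSpaces.
Context {d : measure_display} {T : measurableType d} {R : realType}.
Variable mu : {measure set T -> \bar R}.

Definition Lp_on (D : set T) (p : \bar R) (f : T -> R) : Prop :=
  measurable_fun D f /\ finite_norm mu p (f \_ D).

Definition Lp_onC (D : set T) (p : \bar R) (f : T -> R[i]) : Prop :=
  Lp_on D p (fun x => complex.Re (f x)) /\
  Lp_on D p (fun x => complex.Im (f x)).

End LebesgueSpaces.

Section Sobolev.
Context {R : realType}.
Local Notation mu := (@lebesgue_measure R).
Local Notation mu2 := (mu \x mu)%E.

Definition continuousC {V : topologicalType} (D : set V) (f : V -> R[i]) :
    Prop :=
  {within D, continuous (fun x => complex.Re (f x))} /\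
  {within D, continuous (fun x => complex.Im (f x))}.

(* [g] is the distributional derivative of [u] on the open set [D]. *)
Definition weak_derivative (D : set R) (u g : R -> R) : Prop :=
  [/\ locally_integrable D u, locally_integrable D g &
      forall phi : R -> R, test_function D phi ->
        \int[mu]_(x in D) (u x * 'D_1 phi x) =
        - \int[mu]_(x in D) (g x * phi x)].

Definition weak_derivativeC (D : set R) (u g : R -> R[i]) : Prop :=
  weak_derivative D (fun x => complex.Re (u x)) (fun x => complex.Re (g x)) /\
  weak_derivative D (fun x => complex.Im (u x)) (fun x => complex.Im (g x)).

(* W^{k,p}(D) for [D] open in the line. *)
Fixpoint sobolev (D : set R) (k : nat) (p : \bar R) (u : R -> R[i]) : Prop :=
  if k is k'.+1 then
    Lp_onC mu D p u /\
    exists2 g, weak_derivativeC D u g & sobolev D k' p g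
  else Lp_onC mu D p u.

(* Weak derivative in the direction [v] of a function that is integrable
   on the open set [D] of the plane. *)
Definition weak_derivative2 (D : set (R * R)) (v : R * R)
    (K g : R * R -> R) : Prop :=
  forall phi : R * R -> R, test_function D phi ->
    \int[mu2]_(z in D) (K z * 'D_v phi z) =
    - \int[mu2]_(z in D) (g z * phi z).

Definition weak_derivative2C (D : set (R * R)) (v : R * R)
    (K g : R * R -> R[i]) : Prop :=
  weak_derivative2 D v (fun z => complex.Re (K z)) (fun z => complex.Re (g z)) /\
  weak_derivative2 D v (fun z => complex.Im (K z)) (fun z => complex.Im (g z)).

(* W^{1,oo}(D) for [D] open and bounded in the plane. *)
Definition sobolev2_1oo (D : set (R * R)) (K : R * R -> R[i]) : Prop :=
  Lp_onC mu2 D +oo%E K /\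
  forall v : R * R, v = (1, 0) \/ v = (0, 1) ->
    exists2 g, weak_derivative2C D v K g & Lp_onC mu2 D +oo%E g.

End Sobolev.

Section Transmutation.
Context {R : realType}.
Local Notation mu := (@lebesgue_measure R).
Local Open Scope complex_scope.

Definition cexp (z : R[i]) : R[i] :=
  (expR (complex.Re z))%:C *
  (cos (complex.Im z) +i* sin (complex.Im z)).

Definition cintegral (A : set R) (f : R -> R[i]) : R[i] :=
  (\int[mu]_(t in A) complex.Re (f t)) +i*
  (\int[mu]_(t in A) complex.Im (f t)).

Definition oriented_integral (x y : R) (f : R -> R[i]) : R[i] :=
  if x <= y then cintegral `[x, y] f else - cintegral `[y, x] f.

Definition open_itv (l : R) : set R := `]- l, l[.
Definition closed_itv (l : R) : set R := `[- l, l].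

(* Pointwise values of [a] are those of its continuous representative
   on [-l, l]. *)
Definition impedance (l : R) (a : R -> R) : Prop :=
  [/\ sobolev (open_itv l) 1 +oo%E (fun x => (a x)%:C) /\
        {within closed_itv l, continuous a},
      (forall x, open_itv l x -> 0 < a x),
      Lp_on mu (open_itv l) 2%:E a,
      Lp_on mu (open_itv l) 2%:E (fun x => (a x)^-1) &
      a 0 = 1].

(* [f] is (a version of) a^2 u', the derivative being weak: D_a u = f. *)
Definition is_Da (l : R) (a : R -> R) (u f : R -> R[i]) : Prop :=
  exists2 u' : R -> R[i], weak_derivativeC (open_itv l) u u' &
    {ae mu, forall x, open_itv l x -> (a x)%:C ^+ 2 * u' x = f x}.

(* [e] is e_a(rho, .): the solution of - a^-2 (a^2 e')' = rho^2 e with e(0) = 1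
   and (a^2 e')(0) = i rho; [e] and [z] = a^2 e' are the continuous
   representatives. *)
Definition impedance_exp (l : R) (a : R -> R) (rho : R[i]) (e : R -> R[i]) :
    Prop :=
  [/\ continuousC (closed_itv l) e, e 0 = 1 &
   exists z z' : R -> R[i],
     [/\ is_Da l a e z, continuousC (open_itv l) z, z 0 = 'i%C * rho,
         weak_derivativeC (open_itv l) z z' &
         {ae mu, forall x, open_itv l x ->
           - ((a x)%:C ^- 2 * z' x) = rho ^+ 2 * e x}]].

Definition transmutation_kernel (l : R) (a : R -> R) (K : R * R -> R[i]) :
    Prop :=
  [/\ sobolev2_1oo (open_itv l `*` open_itv l) K /\
        continuousC (closed_itv l `*` closed_itv l) K,
      (forall rho : R[i], exists2 e, impedance_exp l a rho e &
        forall x, closed_itv l x ->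
          e x = cexp ('i%C * rho * x%:C) -
                'i%C * rho * oriented_integral (- x) x
                  (fun t => K (x, t) * cexp ('i%C * rho * t%:C))),
      (forall x, closed_itv l x -> K (x, x) = 1 - ((a x)^-1)%:C) &
      (forall x, closed_itv l x -> K (x, - x) = 0)].

(* T u for the kernel [K], where [u'] is the weak derivative of [u]. *)
Definition transmutation (K : R * R -> R[i]) (u u' : R -> R[i]) (x : R) :
    R[i] :=
  u x - oriented_integral (- x) x (fun t => K (x, t) * u' t).

End Transmutation.

(* Main.v *)
Require Import Defs.
From mathcomp Require Import all_boot all_order all_algebra.
From mathcomp Require Import complex.
From mathcomp Require Import all_classical all_reals all_analysis.
From mathcomp Require Import measurable_realfun ring lra.
Set Implicit Arguments.
Unset Strict Implicit.
Unset Printing Implicit Defensive.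
Import Order.TTheory GRing.Theory Num.Theory.
Import numFieldNormedType.Exports.
Local Open Scope classical_set_scope.
Local Open Scope ring_scope.

(** Both sides are determined by (u(0), u'(0), u''), linearly and, at each fixed
    x, continuously for the L^1 norm of u''. So it is enough to prove
      T_a u(x) = u(0) + int_0^x a^-2 T_{1/a} u'
    for a set of u whose data span a dense subspace. The exponentials
    u = e^{-kx}, k > 0 (that is, rho = i k) are such a set:
    - for them the identity says e_a = 1 - k int_0^x a^-2 e_{1/a}, and this holds
      because a^2 e_a' and -k e_{1/a} solve the same Cauchy problem;
    - u = x is the limit of (1 - e^{-kx})/k as k tends to 0, and the second
      derivatives e^{-kx}, k = 1, 2, ..., are the monomials in y = e^{-x}, dense
      by Bernstein's theorem.
    Between weak derivatives and primitives one goes by the fundamental theorem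
    of calculus at Lebesgue points, tested against smooth steps. *)

(** * Oriented integrals *)

Section OrientedIntegral.
Context {R : realType}.
Local Notation mu := (@lebesgue_measure R).
Implicit Types (f g : R -> R) (l r x y z : R).

(** The identity is integrated from [0] to [x] before it is proved, so no derivative of a kernel is
    ever taken: the representation of e_a is used through values only. The choice rho = i k makes i
    rho = - k, rho^2 = - k^2 and e^{i rho x} real. Hence the real parts and the imaginary parts of
    the two kernels satisfy two separate real identities, with initial values 1 and 0, and for
    complex u each component is a combination of both. T fixes constants, so u(0) drops out and only
    the pair (u'(0), u'') matters. An exponential never has u'(0) = 0 or u'' = 0; this is why the
    limit k to 0 comes in, to isolate the contribution of u'(0). Since k = 0 is excluded, the
    available monomials in y start at degree 1; one factor y is divided out before Bernstein
    approximation and put back afterwards. All estimates are made on [- r, r] with r < l, where a^-2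
    and the kernels are bounded. *)

Definition cont_on l f := forall x, `|x| < l -> {for x, continuous f}.

(* One of the two integrals is over a null set. *)
Definition oint x y f : R :=
  \int[mu]_(t in `[x, y]) f t - \int[mu]_(t in `[y, x]) f t.

Lemma open_itvE l x : open_itv l x = (`|x| < l) :> Prop.
Proof. by rewrite /open_itv /= in_itv/= ltr_norml. Qed.

Lemma open_open_itv l : open (open_itv l).
Proof. exact: interval_open. Qed.

Lemma sub_cc_open_itv l r : r < l -> `[- r, r] `<=` open_itv l.
Proof.
by move=> rl x /=; rewrite in_itv/= -ler_norml open_itvE => /le_lt_trans; exact.
Qed.

Lemma sub_itv_cc r x y : `|x| <= r -> `|y| <= r -> `[x, y] `<=` `[- r, r].
Proof.
rewrite !ler_norml => /andP[rx _] /andP[_ yr] z /=; rewrite !in_itv/=.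
by move=> /andP[/(le_trans rx) -> /le_trans ->].
Qed.

(** The maximum of [|x|] on the compact set is below [l], and [r] is taken halfway between the
    two. *)
Lemma compact_sub_open_itv l (K : set R) : 0 < l -> compact K ->
  K `<=` open_itv l -> exists r, [/\ 0 < r, r < l & K `<=` `]- r, r[].
Proof.
move=> l0 cK Kl.
have [->|/set0P K0] := eqVneq K set0.
  by exists (l / 2); split; [rewrite divr_gt0|lra|exact: sub0set].
have cn : {within K, continuous (fun x : R => `|x|)}.
  by apply: continuous_subspaceT => x; exact: norm_continuous.
have [c Kc cmax] := compact_EVT_max K0 cK cn.
have cl : `|c| < l by rewrite -open_itvE; exact/Kl/set_mem.
exists ((`|c| + l) / 2); have c0 := normr_ge0 c; split; [lra|lra|].
move=> x Kx /=; rewrite in_itv/= -ltr_norml.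
by have := cmax x (mem_set Kx); lra.
Qed.

Lemma locint_cc l r f : locally_integrable (open_itv l) f -> r < l ->
  mu.-integrable `[- r, r] (EFin \o f).
Proof.
move=> [mf _ foo] rl; apply/integrableP; split.
  apply/measurable_EFinP; apply: measurable_funS mf.
    exact: measurable_itv.
  exact: sub_cc_open_itv.
by apply: foo; [exact: sub_cc_open_itv|exact: segment_compact].
Qed.

Lemma locint_itv l f x y : locally_integrable (open_itv l) f ->
  `|x| < l -> `|y| < l -> mu.-integrable `[x, y] (EFin \o f).
Proof.
move=> fl xl yl; have rl : Num.max `|x| `|y| < l by rewrite gt_max xl.
apply: (integrableS _ _ _ (locint_cc fl rl)); [exact: measurable_itv..|].
by apply: sub_itv_cc; rewrite le_max lexx ?orbT.
Qed.

Lemma cont_on_within l f r : cont_on l f -> r < l ->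
  {within `[- r, r], continuous f}.
Proof.
move=> cf rl; apply/subspace_continuousP => x xr.
apply: cvg_within_filter; apply: cf.
by move: xr; rewrite /= in_itv/= -ler_norml => /le_lt_trans; exact.
Qed.

Lemma cont_on_withinS l f x y : cont_on l f -> `|x| < l -> `|y| < l ->
  {within `[x, y], continuous f}.
Proof.
move=> cf xl yl; have rl : Num.max `|x| `|y| < l by rewrite gt_max xl.
apply: continuous_subspaceW (cont_on_within cf rl).
by apply: sub_itv_cc; rewrite le_max lexx ?orbT.
Qed.

Lemma cont_on_bounded l f r : cont_on l f -> r < l ->
  exists2 M, 0 <= M & forall x, `|x| <= r -> `|f x| <= M.
Proof.
move=> cf rl; have cfr := cont_on_within cf rl.
have := continuous_compact cfr (@segment_compact _ _ _).
move=> /compact_bounded[M [_ fM]]; exists (`|M| + 1) => [|x xr].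
  by rewrite addr_ge0.
apply: (fM (`|M| + 1)); first by rewrite (le_lt_trans (ler_norm _))// ltrDl.
by exists x => //=; rewrite in_itv/= -ler_norml.
Qed.

Lemma cont_on_measurable l f : cont_on l f -> measurable_fun (open_itv l) f.
Proof.
move=> cf; apply: open_continuous_measurable_fun; first exact: open_open_itv.
by move=> x /set_mem; rewrite open_itvE; exact: cf.
Qed.

Lemma locint_bounded_mul l f g : measurable_fun (open_itv l) f ->
  (forall r, r < l -> exists M : R, forall x, `|x| <= r -> `|f x| <= M) ->
  locally_integrable (open_itv l) g ->
  locally_integrable (open_itv l) (fun x => f x * g x).
Proof.
move=> mf bf lg; have [mg oI goo] := lg.
split => //; first exact: measurable_funM.
have [l0|l0] := ltP 0 l; last first.
  move=> K KI _; suff -> : K = set0 by rewrite integral_set0.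
  rewrite -subset0 => x /KI; rewrite open_itvE => xl.
  by have := normr_ge0 x; move: (lt_le_trans xl l0); lra.
move=> K KI cK; have [r [r0 rl Kr]] := compact_sub_open_itv l0 cK KI.
have [M fM] := bf _ rl.
have mIr : measurable `[- r, r]%classic by exact: measurable_itv.
have mS (h : R -> R) : measurable_fun (open_itv l) h -> measurable_fun `[- r, r] h.
  by move=> mh; apply: measurable_funS mh;
    [exact: measurable_itv|exact: sub_cc_open_itv].
have bf' : [bounded f x | x in `[- r, r]].
  exists M; split; rewrite ?num_real// => M' MM' x /=.
  by rewrite in_itv/= -ler_norml => /fM /le_trans; apply; exact: ltW.
have : mu.-integrable `[- r, r] ((EFin \o f) \* (EFin \o g))%E.
  by apply: integrableMr; [exact: mIr|exact: mS|exact: bf'|exact: locint_cc lg rl].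
move=> /integrableP[_]; apply: le_lt_trans.
apply: ge0_subset_integral => //=.
- exact: compact_measurable.
- apply/measurable_EFinP; apply: measurableT_comp => //.
  by apply: measurable_funM; exact: mS.
- by move=> x /Kr /=; rewrite !in_itv/= => /andP[/ltW -> /ltW ->].
Qed.

Lemma cont_on_mul_locint l f g : cont_on l f ->
  locally_integrable (open_itv l) g ->
  locally_integrable (open_itv l) (fun x => f x * g x).
Proof.
move=> cf; apply: locint_bounded_mul; first exact: cont_on_measurable.
by move=> r rl; have [M _ fM] := cont_on_bounded cf rl; exists M.
Qed.

Lemma cont_onD l f g : cont_on l f -> cont_on l g -> cont_on l (fun x => f x + g x).
Proof. by move=> cf cg x xl; apply: cvgD; [exact: cf|exact: cg]. Qed.

Lemma cont_onM l f g : cont_on l f -> cont_on l g -> cont_on l (fun x => f x * g x).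
Proof. by move=> cf cg x xl; apply: cvgM; [exact: cf|exact: cg]. Qed.

Lemma cont_on_cst l (c : R) : cont_on l (fun=> c).
Proof. by move=> x _; exact: cvg_cst. Qed.

Lemma cont_onZ l c f : cont_on l f -> cont_on l (fun x => c * f x).
Proof. by move=> cf; apply: cont_onM => //; exact: cont_on_cst. Qed.

Lemma cont_onB l f g : cont_on l f -> cont_on l g -> cont_on l (fun x => f x - g x).
Proof. by move=> cf cg x xl; apply: cvgB; [exact: cf|exact: cg]. Qed.

Lemma cont_onS l r f : r <= l -> cont_on l f -> cont_on r f.
Proof. by move=> rl cf x xr; apply: cf; exact: lt_le_trans rl. Qed.

Lemma locint_mul_cont_on l f g : locally_integrable (open_itv l) g ->
  cont_on l f -> locally_integrable (open_itv l) (fun x => g x * f x).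
Proof.
move=> gl cf; rewrite (_ : (fun x => _) = fun x => f x * g x).
  exact: cont_on_mul_locint.
by apply/funext => x; rewrite mulrC.
Qed.

Lemma locint_cst l (c : R) : locally_integrable (open_itv l) (fun=> c).
Proof.
apply: open_integrable_locally; first exact: open_open_itv.
apply: measurable_bounded_integrable => //.
- exact: measurable_itv.
- by rewrite /open_itv /= lebesgue_measure_itv/=; case: ifPn => _; rewrite ltry.
- exists `|c|; split; rewrite ?num_real// => M cM x _; exact: ltW.
Qed.

Lemma cont_on_locint l f : cont_on l f -> locally_integrable (open_itv l) f.
Proof.
move=> cf; rewrite (_ : f = fun x => f x * 1).
  by apply: cont_on_mul_locint => //; exact: locint_cst.
by apply/funext => x; rewrite mulr1.
Qed.

Lemma locintZ l f c : locally_integrable (open_itv l) f ->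
  locally_integrable (open_itv l) (fun x => c * f x).
Proof.
by apply: cont_on_mul_locint => x _; exact: cvg_cst.
Qed.

Lemma Rint_ge_null x y f : y <= x -> \int[mu]_(t in `[x, y]) f t = 0.
Proof.
rewrite le_eqVlt => /predU1P[->|yx].
  by rewrite set_itv1 Rintegral_set1.
by rewrite set_itv_ge ?bnd_simp -?ltNge// Rintegral_set0.
Qed.

Lemma oint_leE x y f : x <= y -> oint x y f = \int[mu]_(t in `[x, y]) f t.
Proof. by move=> xy; rewrite /oint (Rint_ge_null _ xy) subr0. Qed.

Lemma oint_swap x y f : oint y x f = - oint x y f.
Proof. by rewrite /oint opprB. Qed.

(** As increments of one primitive based at [- r], oriented integrals become additive by mere
    algebra, with no case distinction on the order of the endpoints. *)
Lemma oint_prim r x y f : mu.-integrable `[- r, r] (EFin \o f) ->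
  `|x| <= r -> `|y| <= r ->
  oint x y f = \int[mu]_(t in `[- r, y]) f t - \int[mu]_(t in `[- r, x]) f t.
Proof.
move=> fi; wlog xy : x y / x <= y.
  move=> H xr yr; have [xy|/ltW yx] := leP x y; first exact: H.
  by rewrite oint_swap (H _ _ yx)// opprB.
move=> xr yr; rewrite oint_leE//.
have r0 : 0 <= r by exact: le_trans xr.
have rr : `|- r| <= r by rewrite normrN ger0_norm.
have fiy : mu.-integrable `[- r, y] (EFin \o f).
  apply: (integrableS _ _ _ fi); [exact: measurable_itv..|exact: sub_itv_cc].
have rx : - r <= x by move: xr; rewrite ler_norml => /andP[].
rewrite Rintegral_itvB ?bnd_simp// Rintegral_itv_obnd_cbnd//.
apply: (integrableS _ _ _ fiy); [exact: measurable_itv..|].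
by move=> z /=; rewrite !in_itv/= => /andP[xz ->]; rewrite andbT (le_trans rx)// ltW.
Qed.

Lemma maxnorm_lt l x y : `|x| < l -> `|y| < l ->
  exists r, [/\ `|x| <= r, `|y| <= r & r < l].
Proof.
move=> xl yl; exists (Num.max `|x| `|y|).
by rewrite !le_max !lexx orbT gt_max xl yl.
Qed.

Lemma oint_add l f x y z : locally_integrable (open_itv l) f ->
  `|x| < l -> `|y| < l -> `|z| < l -> oint x z f = oint x y f + oint y z f.
Proof.
move=> fl xl yl zl; have [s [xs ys sl]] := maxnorm_lt xl yl.
have [r [sr zr rl]] : exists r, [/\ s <= r, `|z| <= r & r < l].
  by exists (Num.max s `|z|); rewrite !le_max !lexx orbT gt_max sl zl.
have fr := locint_cc fl rl.
have [xr yr] : `|x| <= r /\ `|y| <= r by split; exact: le_trans sr.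
rewrite !(oint_prim fr)//.
by ring.
Qed.

Lemma oint0 x f : oint x x f = 0. Proof. by rewrite /oint subrr. Qed.

Lemma ointD l f g x y : locally_integrable (open_itv l) f ->
  locally_integrable (open_itv l) g -> `|x| < l -> `|y| < l ->
  oint x y (fun t => f t + g t) = oint x y f + oint x y g.
Proof.
move=> fl gl xl yl; rewrite /oint !RintegralD//; first by rewrite opprD addrACA.
all: by [exact: measurable_itv|exact: locint_itv fl _ _|exact: locint_itv gl _ _].
Qed.

Lemma ointZ l f c x y : locally_integrable (open_itv l) f ->
  `|x| < l -> `|y| < l -> oint x y (fun t => c * f t) = c * oint x y f.
Proof.
move=> fl xl yl; rewrite /oint !RintegralZl//; first by rewrite mulrBr.
all: by [exact: measurable_itv|exact: locint_itv fl _ _].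
Qed.

Lemma ointB l f g x y : locally_integrable (open_itv l) f ->
  locally_integrable (open_itv l) g -> `|x| < l -> `|y| < l ->
  oint x y (fun t => f t - g t) = oint x y f - oint x y g.
Proof.
move=> fl gl xl yl; rewrite /oint !RintegralB//; first by lra.
all: by [exact: measurable_itv|exact: locint_itv fl _ _|exact: locint_itv gl _ _].
Qed.

Lemma eq_oint r f g x y : (forall t, `|t| <= r -> f t = g t) ->
  `|x| <= r -> `|y| <= r -> oint x y f = oint x y g.
Proof.
move=> fg xr yr; congr (_ - _); apply: eq_Rintegral => t /set_mem/= txy;
  apply: fg; rewrite ler_norml.
- by have := sub_itv_cc xr yr txy; rewrite /= in_itv.
- by have := sub_itv_cc yr xr txy; rewrite /= in_itv.
Qed.

Lemma ae_eq_oint l r f g x y : locally_integrable (open_itv l) f ->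
  locally_integrable (open_itv l) g -> r < l ->
  {ae mu, forall t, `|t| < r -> f t = g t} ->
  `|x| < r -> `|y| < r -> oint x y f = oint x y g.
Proof.
move=> fl gl rl fg xr yr.
have H (u v : R) : `|u| < r -> `|v| < r ->
    \int[mu]_(t in `[u, v]) f t = \int[mu]_(t in `[u, v]) g t.
  move=> ur vr; congr fine; apply: ae_eq_integral.
  - exact: measurable_itv.
  - exact: measurable_int (locint_itv fl (lt_trans ur rl) (lt_trans vr rl)).
  - exact: measurable_int (locint_itv gl (lt_trans ur rl) (lt_trans vr rl)).
  - move: fg; apply: filterS; first exact: (ae_filter_ringOfSetsType mu).
    move=> t fg /= tuv; congr EFin; apply: fg.
    move: tuv ur vr; rewrite /= in_itv/= !ltr_norml.
    by move=> /andP[ut tv] /andP[u1 u2] /andP[v1 v2]; apply/andP; split; lra.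
by congr (_ - _); exact: H.
Qed.

Lemma Rint_norm_le r f x y : mu.-integrable `[- r, r] (EFin \o f) ->
  `|x| <= r -> `|y| <= r ->
  `|\int[mu]_(t in `[x, y]) f t| <= \int[mu]_(t in `[- r, r]) `|f t|.
Proof.
move=> fi xr yr.
have ms := sub_itv_cc xr yr.
have fxy : mu.-integrable `[x, y] (EFin \o f).
  by apply: (integrableS _ _ _ fi) => //; exact: measurable_itv.
apply: le_trans (le_normr_Rintegral _ fxy) _; first exact: measurable_itv.
rewrite fine_le//.
- by apply: integrable_fin_num => //; exact: (integrable_norm fxy).
- by apply: integrable_fin_num => //; exact: (integrable_norm fi).
- apply: ge0_subset_integral => //.
  apply/measurable_EFinP; apply: measurableT_comp => //.
  by apply/measurable_EFinP; exact: measurable_int fi.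
Qed.

Lemma oint_norm_le r f x y : mu.-integrable `[- r, r] (EFin \o f) ->
  `|x| <= r -> `|y| <= r ->
  `|oint x y f| <= \int[mu]_(t in `[- r, r]) `|f t|.
Proof.
move=> fi; wlog xy : x y / x <= y.
  move=> H xr yr; have [xy|/ltW yx] := leP x y; first exact: H.
  by rewrite oint_swap normrN H.
by move=> xr yr; rewrite oint_leE//; exact: Rint_norm_le.
Qed.

Lemma Rint_le_cst r f M : 0 <= r -> mu.-integrable `[- r, r] (EFin \o f) ->
  (forall t, `|t| <= r -> `|f t| <= M) ->
  \int[mu]_(t in `[- r, r]) `|f t| <= M * (2 * r).
Proof.
move=> r0 fi fM.
have -> : M * (2 * r) = \int[mu]_(t in `[- r, r]) M.
  rewrite Rintegral_cst; last exact: measurable_itv.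
  congr (_ * _); rewrite /= lebesgue_measure_itv/= lte_fin.
  by case: ltP => /=; lra.
apply: le_Rintegral.
- exact: measurable_itv.
- exact: (integrable_norm fi).
- apply: measurable_bounded_integrable => //.
    by rewrite /= lebesgue_measure_itv/=; case: ifPn => _; rewrite ltry.
  exists `|M|; split; rewrite ?num_real// => M' cM x _; exact: ltW.
- by move=> x /=; rewrite in_itv/= -ler_norml => /fM.
Qed.

Lemma oint_norm_cst l r f M x y : locally_integrable (open_itv l) f ->
  r < l -> (forall t, `|t| <= r -> `|f t| <= M) ->
  `|x| <= r -> `|y| <= r -> `|oint x y f| <= M * (2 * r).
Proof.
move=> fl rl fM xr yr; have fi := locint_cc fl rl.
apply: le_trans (oint_norm_le fi xr yr) _.
by apply: Rint_le_cst => //; rewrite (le_trans _ xr).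
Qed.

Lemma near_norm_lt l x : `|x| < l -> \forall y \near x, `|y| < l.
Proof.
move=> xl; have : nbhs x (open_itv l).
  by apply: open_nbhs_nbhs; split; [exact: open_open_itv|rewrite open_itvE].
by apply: filterS => y; rewrite open_itvE.
Qed.

Lemma oint_cont l f c : locally_integrable (open_itv l) f -> `|c| < l ->
  cont_on l (fun x => oint c x f).
Proof.
move=> fl cl x xl; have [s [cs xs sl]] := maxnorm_lt cl xl.
(* [r] is strictly above [s], so [x] is interior to [- r, r] and continuity there is two-sided. *)
pose r := (s + l) / 2; have rl : r < l by rewrite /r; lra.
have sr : s < r by rewrite /r; lra.
have fr := locint_cc fl rl.
have cr : `|c| <= r by rewrite (le_trans cs)// ltW.
have r0 : 0 < r by rewrite (le_lt_trans _ sr)// (le_trans _ cs).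
have xr' : `|x| <= r by rewrite (le_trans xs)// ltW.
have rr : - r < r by lra.
have := parameterized_integral_continuous (ltW rr) fr.
move/(continuous_within_itvP _ rr) => [+ _ _] => /(_ x).
have xr : x \in `]- r, r[ by rewrite in_itv/= -ltr_norml (le_lt_trans xs).
move=> /(_ xr) cx.
have cx' : {for x, continuous (fun y : R =>
    parameterized_integral mu (- r) y f - parameterized_integral mu (- r) c f)}.
  by apply: cvgB; [exact: cx|exact: cvg_cst].
rewrite /prop_for /continuous_at (oint_prim fr)//; move: cx'.
apply: cvg_trans; apply: near_eq_cvg.
have : \forall y \near x, `|y| < r by apply: near_norm_lt; exact: le_lt_trans sr.
by apply: filterS => y yr; rewrite (oint_prim fr) ?(ltW yr) ?cr.
Qed.

Lemma oint_is_derive l f c x : locally_integrable (open_itv l) f ->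
  {for x, continuous f} -> `|c| < l -> `|x| < l ->
  is_derive x 1 (fun y => oint c y f) (f x).
Proof.
move=> fl cf cl xl; have [s [cs xs sl]] := maxnorm_lt cl xl.
pose r := (s + l) / 2; have rl : r < l by rewrite /r; lra.
have sr : s < r by rewrite /r; lra.
have fr := locint_cc fl rl.
have xr : `|x| < r by exact: le_lt_trans sr.
have cr : `|c| <= r by rewrite (le_trans cs)// ltW.
have [rx xr'] : - r < x /\ x < r by apply/andP; rewrite -ltr_norml.
have [dF DF] := continuous_FTC1_closed xr' fr rx cf.
have dG : is_derive x 1 (fun y => \int[mu]_(t in `[- r, y]) f t -
    \int[mu]_(t in `[- r, c]) f t) (f x).
  apply: is_derive_eq; first apply: is_deriveB; first exact: (derivableP dF).
  by rewrite -derive1E DF subr0.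
apply: near_eq_is_derive dG.
have : \forall y \near x, `|y| < r by exact: near_norm_lt.
by apply: filterS => y yr; rewrite (oint_prim fr) ?(ltW yr) ?cr.
Qed.

Lemma cont_on_is_derive l (F f : R -> R) :
  (forall x, `|x| < l -> is_derive x 1 F (f x)) -> cont_on l F.
Proof.
move=> dF x xl; apply: differentiable_continuous.
by apply/derivable1_diffP; have [] := dF x xl.
Qed.

Lemma oint_FTC2 l (F f : R -> R) x y :
  (forall x, `|x| < l -> is_derive x 1 F (f x)) -> cont_on l f ->
  `|x| < l -> `|y| < l -> oint x y f = F y - F x.
Proof.
move=> dF cf; wlog xy : x y / x < y.
  move=> H xl yl; have [xy|yx|->] := ltgtP x y; first exact: H.
    by rewrite oint_swap H// opprB.
  by rewrite oint0 subrr.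
move=> xl yl; rewrite oint_leE 1?ltW//.
have dl t : t \in `]x, y[ -> `|t| < l.
  move: xl yl; rewrite in_itv/= !ltr_norml.
  by move=> /andP[? ?] /andP[? ?] /andP[? ?]; apply/andP; split; lra.
have cF := cont_on_is_derive dF.
rewrite /Rintegral (@continuous_FTC2 _ f F)//.
- exact: cont_on_withinS cf _ _.
- split.
  + by move=> t /dl/dF[].
  + by apply: cvg_at_right_filter; exact: cF.
  + by apply: cvg_at_left_filter; exact: cF.
- by move=> t /dl/dF tF; rewrite derive1E; apply: derive_val.
Qed.

End OrientedIntegral.

(** * A smooth step function *)

Section SmoothStep.
Context {R : realType}.
Implicit Types (f g : R -> R) (x y : R).

Fixpoint Cn (n : nat) f : Prop :=
  if n is n'.+1 then (forall x, derivable f x 1) /\ Cn n' (derive1 f)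
  else continuous f.

Lemma CnSP n f f' : (forall x, is_derive x 1 f (f' x)) -> Cn n f' ->
  Cn n.+1 f.
Proof.
move=> df f'n; split => [x|]; first by have [] := df x.
suff -> : (derive1 f) = f' by [].
by apply/funext => x; rewrite derive1E; apply: derive_val.
Qed.

Lemma Cn_is_derive n f x : Cn n.+1 f -> is_derive x 1 f (derive1 f x).
Proof. by move=> [df _]; rewrite derive1E; exact: derivableP. Qed.

Lemma CnS n f : Cn n.+1 f -> Cn n f.
Proof.
elim: n f => [f [df _] x|n IH f [df dn]]; last by split => //; exact: IH.
by apply: differentiable_continuous; apply/derivable1_diffP.
Qed.

Lemma Cn_cst n c : Cn n (fun=> c).
Proof.
elim: n c => [c x|n IH c]; first exact: cvg_cst.
by apply: (CnSP _ (IH 0)) => x; exact: is_derive_cst.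
Qed.

Lemma CnD n f g : Cn n f -> Cn n g -> Cn n (fun x => f x + g x).
Proof.
elim: n f g => [f g cf cg x|n IH f g fn gn].
  by apply: cvgD; [exact: cf|exact: cg].
apply: (CnSP _ (IH _ _ fn.2 gn.2)) => x.
exact: (is_deriveD (Cn_is_derive x fn) (Cn_is_derive x gn)).
Qed.

Lemma CnM n f g : Cn n f -> Cn n g -> Cn n (fun x => f x * g x).
Proof.
elim: n f g => [f g cf cg x|n IH f g fn gn].
  by apply: cvgM; [exact: cf|exact: cg].
apply: (@CnSP _ _ (fun x => f x * derive1 g x + g x * derive1 f x)) => [x|].
  exact: (is_deriveM (Cn_is_derive x fn) (Cn_is_derive x gn)).
by apply: CnD; apply: IH => //; [exact: CnS|exact: gn.2|exact: CnS|exact: fn.2].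
Qed.

Lemma CnZ n c f : Cn n f -> Cn n (fun x => c * f x).
Proof. by apply: CnM; exact: Cn_cst. Qed.

Lemma CnV n f : (forall x, f x != 0) -> Cn n f -> Cn n (fun x => (f x)^-1).
Proof.
move=> f0; elim: n => [cf x|n IH fn].
  by apply: cvgV; [exact: f0|exact: cf].
apply: (@CnSP _ _ (fun x => -1 * (((f x)^-1 * (f x)^-1) * derive1 f x))) => [x|].
  apply: is_derive_eq; first exact: (is_deriveV (f0 x) (Cn_is_derive x fn)).
  by rewrite /GRing.scale/= -exprVn; ring.
apply/CnZ/CnM; last exact: fn.2.
by apply: CnM; apply: IH; exact: CnS.
Qed.

Lemma Cn_affine n f (p q : R) : Cn n f -> Cn n (fun x => f (p * x + q)).
Proof.
elim: n f => [f cf x|n IH f fn].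
  apply: (@continuous_comp _ _ _ (fun x => p * x + q) f); last exact: cf.
  by apply: cvgD; [apply: cvgM; [exact: cvg_cst|exact: cvg_id]|exact: cvg_cst].
apply: (@CnSP _ _ (fun x => p * derive1 f (p * x + q))) => [x|].
  have : is_derive x 1 (fun x => p * x + q) p.
    have := is_deriveD (is_deriveZ p (is_derive_id x 1)) (is_derive_cst q x 1).
    by rewrite /GRing.scale/= mulr1 addr0.
  move=> /(@is_derive1_comp _ f (fun x => p * x + q) x _ _ (Cn_is_derive _ fn)).
  by rewrite [_ * p]mulrC.
by apply: CnZ; exact: IH fn.2.
Qed.

Lemma derive_scaled f x v : derivable f x 1 -> 'D_v f x = v * derive1 f x.
Proof.
move=> /derivable1_diffP df; rewrite derive1E !deriveE//.
by rewrite -[v in LHS]mulr1 -[v * 1]/(v *: (1 : R)) linearZ.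
Qed.

(** On the line the derivative along [v] is [v] times [derive1], so every iterated directional
    derivative stays in all the classes [Cn n]. *)
Lemma Cn_smooth f : (forall n, Cn n f) -> smooth f.
Proof.
move=> fn; have H vs : forall n, Cn n (iter_derive vs f).
  elim: vs => //= v vs IH n.
  have -> : (fun x => 'D_v (iter_derive vs f) x) =
      fun x => v * derive1 (iter_derive vs f) x.
    by apply/funext => x; rewrite derive_scaled//; exact: (IH 1%N).1.
  by apply: CnZ; exact: (IH n.+1).2.
move=> vs; split; first exact: (H vs 0%N).
move=> x v; apply: diff_derivable; apply/derivable1_diffP.
exact: (H vs 1%N).1.
Qed.

(** The power [m] is carried along to close the family under differentiation: the derivative of x^-m
    e^{-1/x} combines the members [m.+2] and [m.+1]. The function of interest is [flat 0]. *)
Definition flat (m : nat) x : R :=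
  if 0 < x then x^-1 ^+ m * expR (- x^-1) else 0.

(** For [0 < x], e^{1/x} exceeds the single term x^-(m+1) / (m+1)! of its series. *)
Lemma flat_le m x : `|flat m x| <= (m.+1)`!%:R * `|x|.
Proof.
rewrite /flat; case: ifPn => x0; last by rewrite normr0 mulr_ge0.
have xV0 : 0 < x^-1 by rewrite invr_gt0.
rewrite gtr0_norm; last by rewrite mulr_gt0 ?expR_gt0// exprn_gt0.
rewrite gtr0_norm// expRN.
have := expR_ge1Dxn m (ltW xV0).
have F0 : (0 : R) < (m.+1)`!%:R by rewrite ltr0n fact_gt0.
have p0 : 0 < x^-1 ^+ m.+1 by rewrite exprn_gt0.
move=> H; rewrite ler_pdivrMr ?expR_gt0//.
apply: (@le_trans _ _ ((m.+1)`!%:R * x * (x^-1 ^+ m.+1 / (m.+1)`!%:R))).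
  rewrite exprS le_eqVlt; apply/orP; left; apply/eqP; field.
  by rewrite !gt_eqF.
by rewrite ler_wpM2l ?mulr_ge0 ?ltW// (lt_le_trans _ H)// ltrDr.
Qed.

Lemma flat_continuous0 m : {for 0, continuous (flat m)}.
Proof.
have f0 : flat m 0 = 0 by rewrite /flat ltxx.
rewrite /prop_for /continuous_at f0.
apply/cvgr0Pnorm_lt => e e0.
have F0 : (0 : R) < (m.+1)`!%:R by rewrite ltr0n fact_gt0.
have : \forall x \near (0 : R), `|x| < e / (m.+1)`!%:R.
  by apply: near_norm_lt; rewrite normr0 divr_gt0.
apply: filterS => x; rewrite ltr_pdivlMr// mulrC; apply: le_lt_trans.
exact: flat_le.
Qed.

Lemma flat_is_derive m x :
  is_derive x 1 (flat m) (flat m.+2 x + - m%:R * flat m.+1 x).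
Proof.
have [x0|x0|<-] := ltgtP 0 x.
- apply: (@near_eq_is_derive _ _ _ (fun x => x^-1 ^+ m * expR (- x^-1))).
    by near=> y; rewrite /flat ifT//; near: y; exact: lt_nbhsr.
  have dV : is_derive x 1 (fun y : R => y^-1) (- (x^-1 ^+ 2)).
    have := is_deriveV (lt0r_neq0 x0) (is_derive_id x 1).
    by rewrite /GRing.scale/= mulr1 exprVn.
  have dX : is_derive x 1 (fun y : R => y^-1 ^+ m)
      (m%:R * x^-1 ^+ m.-1 * (- (x^-1 ^+ 2))).
    by have := is_deriveX m dV; rewrite exprfctE.
  have dE : is_derive x 1 (fun y : R => expR (- y^-1))
      (expR (- x^-1) * x^-1 ^+ 2).
    have dN := is_deriveN dV; rewrite opprK in dN.
    exact: (@is_derive1_comp _ _ (fun y => - y^-1) _ _ _ (is_derive_expR _) dN).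
  apply: (is_derive_eq (f := fun x => x^-1 ^+ m * expR (- x^-1))).
  (* The exponent [m.-1] is truncated at [m = 0], where its coefficient [m%:R] vanishes. *)
  rewrite /flat x0 /GRing.scale/=; case: m {dX} => [|m] /=; rewrite !exprS; ring.
- apply: (@near_eq_is_derive _ _ _ (fun=> 0)).
    near=> y; rewrite /flat ifF//; apply/negbTE; rewrite -leNgt.
    by near: y; apply: filterS (lt_nbhsl x0) => z /ltW.
  apply: is_derive_eq.
  by rewrite /flat ltNge (ltW x0)/= mulr0 addr0.
(* At [0] the difference quotient of [flat m] is [flat m.+1], which is continuous there with value
   [0]. *)
- apply/is_derive1_caratheodory; exists (flat m.+1); split.
  + move=> z; rewrite /flat ltxx subr0 subr0; case: ifPn => z0; last by rewrite mul0r.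
    by rewrite exprS; field; rewrite gt_eqF.
  + exact: flat_continuous0.
  + by rewrite /flat ltxx mulr0 addr0.
Unshelve. all: by end_near. Qed.

Lemma flat_Cn n m : Cn n (flat m).
Proof.
elim: n m => [m x|n IH m].
  apply: differentiable_continuous; apply/derivable1_diffP.
  by have [] := flat_is_derive m x.
apply: (CnSP (flat_is_derive m)); apply: CnD; first exact: IH.
exact: CnZ.
Qed.

(** The standard quotient f(x) / (f(x) + f(1 - x)) with f = [flat 0]. Its denominator never
    vanishes, since [x] or [1 - x] is positive; [-1 * x + 1] has the shape treated by
    [Cn_affine]. *)
Definition sigma x : R := flat 0 x * (flat 0 x + flat 0 (-1 * x + 1))^-1.

Lemma flat_ge0 m x : 0 <= flat m x.
Proof.
rewrite /flat; case: ifPn => x0 //.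
by rewrite mulr_ge0 ?expR_ge0// exprn_ge0// invr_ge0 ltW.
Qed.

Lemma flat_eq0 m x : x <= 0 -> flat m x = 0.
Proof. by rewrite /flat ltNge => ->. Qed.

Lemma flat_gt0 m x : 0 < x -> 0 < flat m x.
Proof.
by move=> x0; rewrite /flat x0 mulr_gt0 ?expR_gt0// exprn_gt0// invr_gt0.
Qed.

Lemma sigma_den_gt0 x : 0 < flat 0 x + flat 0 (-1 * x + 1).
Proof.
have [x0|x0] := ltP 0 x.
  by rewrite ltr_wpDr ?flat_ge0 ?flat_gt0.
by rewrite ltr_wpDl ?flat_ge0 ?flat_gt0//; lra.
Qed.

Lemma sigma_Cn n : Cn n sigma.
Proof.
apply: CnM; first exact: flat_Cn.
apply: CnV => [x|]; first by rewrite gt_eqF// sigma_den_gt0.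
by apply: CnD; [exact: flat_Cn|apply: Cn_affine; exact: flat_Cn].
Qed.

Lemma sigma_eq0 x : x <= 0 -> sigma x = 0.
Proof. by move=> x0; rewrite /sigma flat_eq0// mul0r. Qed.

Lemma sigma_eq1 x : 1 <= x -> sigma x = 1.
Proof.
move=> x1; have := sigma_den_gt0 x; rewrite /sigma (@flat_eq0 0 (-1 * x + 1)); last lra.
by rewrite addr0 => f0; rewrite mulfV// gt_eqF.
Qed.

Lemma sigma_ge0 x : 0 <= sigma x.
Proof. by rewrite mulr_ge0 ?flat_ge0// invr_ge0 ltW// sigma_den_gt0. Qed.

Lemma sigma_le1 x : sigma x <= 1.
Proof. by rewrite ler_pdivrMr ?sigma_den_gt0// mul1r lerDl flat_ge0. Qed.

Lemma sigma'_eq0 x : x \notin `[0, 1] -> derive1 sigma x = 0.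
Proof.
rewrite in_itv/= negb_and -!ltNge derive1E => /orP[x0|x1].
- have : is_derive x 1 sigma 0.
    apply: (@near_eq_is_derive _ _ _ (fun=> 0)).
    by near=> y; rewrite sigma_eq0//; near: y; apply: filterS (lt_nbhsl x0) => z /ltW.
  by move=> ?; exact: derive_val.
- have : is_derive x 1 sigma 0.
    apply: near_eq_is_derive (is_derive_cst (1 : R) x 1).
    by near=> y; rewrite sigma_eq1//; near: y; apply: filterS (lt_nbhsr x1) => z /ltW.
  by move=> ?; exact: derive_val.
Unshelve. all: by end_near. Qed.

Lemma sigma'_bounded : exists2 C, 0 <= C & forall x, `|derive1 sigma x| <= C.
Proof.
have cs : cont_on 2 (derive1 sigma) by move=> x _; exact: (sigma_Cn 1).2.
have [C C0 sC] := cont_on_bounded cs (ltr1n R 2).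
exists C => // x; have [x01|x01] := boolP (x \in `[0, 1]).
  apply: sC; move: x01; rewrite in_itv/= ler_norml => /andP[? ?]; apply/andP.
  by split; lra.
by rewrite sigma'_eq0// normr0.
Qed.

End SmoothStep.

(** * Functions with a weak derivative are primitives *)

Section WeakDerivative.
Context {R : realType}.
Local Notation mu := (@lebesgue_measure R).
Implicit Types (f g u : R -> R) (x y r l : R).

Lemma Rint_shrink (A B : set R) f : B `<=` A ->
  (forall x, A x -> ~ B x -> f x = 0) ->
  \int[mu]_(x in A) f x = \int[mu]_(x in B) f x.
Proof.
move=> BA f0; rewrite Rintegral_mkcond [RHS]Rintegral_mkcond.
congr Rintegral; apply/funext => x; rewrite !patchE.
have [xA|xA] := boolP (x \in A); have [xB|xB] := boolP (x \in B) => //.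
- by apply: f0; [exact/set_mem|move=> /mem_set; exact/negP].
- by move: xA; rewrite (mem_set (BA _ (set_mem xB))).
Qed.

(** Lebesgue points control centred averages, while the ramps below rise only to the right of their
    foot. The closed interval [x, x + r] lies in the open ball of radius [2 * r], of measure
    [4 * r]; hence the [e / 4] asked of the averages. *)
Lemma lebesgue_pt_right f x (e : R) : locally_integrable [set: R] f ->
  lebesgue_pt f x -> 0 < e ->
  exists2 d, 0 < d & forall r, 0 < r -> r < d ->
    \int[mu]_(y in `[x, x + r]) `|f y - f x| <= e * r.
Proof.
move=> lf fx e0; have e4 : 0 < e / 4 by rewrite divr_gt0.
move: (fx) => /fine_cvgP [finx /cvgrPdist_lt /(_ _ e4) cx].
have [d /= d0 dx] : \forall s \near 0^'+, davg f x s \is a fin_num /\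
    `|0 - fine (davg f x s)| < e / 4.
  by apply: filterS2 finx cx.
exists (d / 2) => [|s s0 sd]; first by rewrite divr_gt0.
have s20 : 0 < 2 * s by rewrite mulr_gt0.
have [fin small] : davg f x (2 * s) \is a fin_num /\
    `|0 - fine (davg f x (2 * s))| < e / 4.
  apply: dx => //=; rewrite distrC subr0 gtr0_norm//; lra.
move: small fin; rewrite sub0r normrN /davg /iavg lebesgue_measure_ball ?(ltW s20)//.
have mf : measurable_fun setT (fun y => (`|f y - f x|)%:E).
  apply/measurable_EFinP/measurableT_comp => //.
  by apply: measurable_funB => //; have [] := lf.
set A : set R := `[x, x + s]%classic; set B : set R := ball x (2 * s).
have xs_ball : A `<=` B.
  move=> y; rewrite /A /B /ball/= in_itv/= ltr_norml => /andP[? ?].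
  by apply/andP; split; lra.
have : (\int[mu]_(y in A) (`|f y - f x|)%:E <=
    \int[mu]_(y in B) (`|f y - f x|)%:E)%E.
  apply: ge0_subset_integral => //; [exact: measurable_itv|exact: measurable_ball|].
  exact: measurable_funTS.
have : (0 <= \int[mu]_(y in A) (`|f y - f x|)%:E)%E.
  exact: integral_ge0.
rewrite /Rintegral inver mulrn_eq0/= (gt_eqF s20)/=.
case: (\int[mu]_(y in A) _)%E => [j| |]//;
  case: (\int[mu]_(y in B) _)%E => [J| |]//=.
- rewrite !lee_fin => j0 jJ + _; rewrite ger0_norm; last first.
    by apply: mulr_ge0; [rewrite invr_ge0 mulrn_wge0// ltW|exact: le_trans jJ].
  by rewrite ltr_pdivrMl ?pmulrn_lgt0//; lra.
(* An infinite integral over the ball would contradict the finiteness of the average. *)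
- by rewrite mulry gtr0_sg ?mul1e// invr_gt0 pmulrn_lgt0.
- by rewrite mulry gtr0_sg ?mul1e// invr_gt0 pmulrn_lgt0.
Qed.

(** For [0 < k], a smooth step from 0 to 1 that rises within [a, a + k^-1]. *)
Definition ramp (k a y : R) : R := sigma (k * y + - (k * a)).

Lemma ramp_is_derive (k a y : R) :
  is_derive y 1 (ramp k a) (k * derive1 sigma (k * y + - (k * a))).
Proof.
have : is_derive y 1 (fun x => k * x + - (k * a)) k.
  have := is_deriveD (is_deriveZ k (is_derive_id y 1)) (is_derive_cst (- (k * a)) y 1).
  by rewrite /GRing.scale/= mulr1 addr0.
move=> /(@is_derive1_comp _ sigma _ y _ _ (Cn_is_derive _ (sigma_Cn 1))).
by rewrite [_ * k]mulrC.
Qed.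

Lemma ramp_smooth (k a : R) n : Cn n (ramp k a).
Proof. by apply: Cn_affine; exact: sigma_Cn. Qed.

Lemma ramp'_cont (k a : R) :
  continuous (fun y => k * derive1 sigma (k * y + - (k * a))).
Proof.
suff : Cn 0 (fun y => k * derive1 sigma (k * y + - (k * a))) by [].
by apply: CnZ; apply: Cn_affine; exact: (sigma_Cn 1).2.
Qed.

Lemma ramp_eq0 (k a y : R) : 0 <= k -> y <= a -> ramp k a y = 0.
Proof. by move=> k0 ya; apply: sigma_eq0; rewrite -mulrBr mulr_ge0_le0// subr_le0. Qed.

Lemma ramp_eq1 (k a y : R) : 1 <= k * (y - a) -> ramp k a y = 1.
Proof. by move=> h; apply: sigma_eq1; rewrite -mulrBr. Qed.

Lemma ramp_norm_le1 (k a b y : R) : `|ramp k a y - ramp k b y| <= 1.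
Proof.
rewrite /ramp; set s := sigma _; set t := sigma _.
have [? ?] : 0 <= s /\ s <= 1 by rewrite sigma_ge0 sigma_le1.
have [? ?] : 0 <= t /\ t <= 1 by rewrite sigma_ge0 sigma_le1.
by rewrite ler_norml; apply/andP; split; lra.
Qed.

Lemma ramp_cvg1 (a y : R) : a < y -> \forall n \near \oo, ramp n.+1%:R a y = 1.
Proof.
move=> ay; near=> n; apply: ramp_eq1; rewrite -ler_pdivrMr ?subr_gt0// mul1r.
rewrite (@le_trans _ _ n%:R)// ?ler_nat//.
by near: n; exact: nbhs_infty_ger.
Unshelve. all: by end_near. Qed.

Lemma ramp'_eq0 (k a y : R) : 0 < k -> ~~ (a <= y <= a + k^-1) ->
  derive1 sigma (k * y + - (k * a)) = 0.
Proof.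
move=> k0 ay; apply: sigma'_eq0; move: ay; rewrite in_itv/=; apply: contra.
rewrite -mulrBr pmulr_rge0// subr_ge0 => /andP[-> /=].
by rewrite -ler_pdivlMl// mulr1; lra.
Qed.

Lemma ramp_support (a b k : R) : 0 < k -> a < b ->
  [set y | ramp k a y - ramp k b y != 0] `<=` `[a, b + k^-1].
Proof.
move=> k0 ab y /=; rewrite in_itv/=; apply: contraR; rewrite negb_and -!ltNge.
have kV : 0 < k^-1 by rewrite invr_gt0.
have k0' := ltW k0.
move=> /orP[ya|yb].
  by rewrite !ramp_eq0 ?subrr// ltW// (lt_trans ya).
have kyb : k^-1 <= y - b by lra.
have /ramp_eq1 -> : 1 <= k * (y - b) by rewrite -ler_pdivrMl// mulr1.
by rewrite (@ramp_eq1 k a) ?subrr// -ler_pdivrMl// mulr1; lra.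
Qed.

Lemma ramp_test_function (l a b k : R) : 0 < k -> - l < a -> a < b ->
  b + k^-1 < l ->
  test_function (open_itv l) (fun y => ramp k a y - ramp k b y).
Proof.
move=> k0 la ab bl; have S := ramp_support k0 ab.
have cS : closure [set y | ramp k a y - ramp k b y != 0] `<=` `[a, b + k^-1].
  have : closed (`[a, b + k^-1] : set R) by exact: interval_closed.
  by move=> /closure_id ->; exact: closureS.
split.
- apply: Cn_smooth => n.
  rewrite (_ : (fun y => _) = fun y => ramp k a y + -1 * ramp k b y).
    by apply: CnD; [|apply: CnZ]; exact: ramp_smooth.
  by apply/funext => y; rewrite mulN1r.
- apply: subclosed_compact cS; first exact: closed_closure.
  exact: segment_compact.
- apply: subset_trans cS _ => y /=; rewrite in_itv/= open_itvE ltr_norml.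
  by move=> /andP[ay yb]; apply/andP; split; lra.
Qed.

(** The derivative of the ramp has integral 1, support in [a, a + k^-1] and height at most [k * C].
    The error is thus at most [C] times the mean of [|u y - u a|] over that interval, which is small
    at a Lebesgue point. The restriction to [- r, r] extends [u] by zero to a function integrable on
    the line. *)
Lemma ramp'_cvg l r u a : locally_integrable (open_itv l) u -> r < l ->
  lebesgue_pt (u \_ `[- r, r]) a -> `|a| < r ->
  \int[mu]_(y in `[- r, r]) (u y * (n.+1%:R * derive1 sigma (n.+1%:R * y + - (n.+1%:R * a))))
   @[n --> \oo] --> u a.
Proof.
move=> ul rl la ar; have ur := locint_cc ul rl.
have mI : measurable (`[- r, r]%classic : set R) by exact: measurable_itv.
have lf := integrable_locally mI ur.
have [C C0 sC] := @sigma'_bounded R.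
apply/cvgrPdist_le => e e0.
(* [C + 1] and not [C], because [C] is only known to be nonnegative. *)
have eC : 0 < e / (C + 1) by rewrite divr_gt0// ltr_wpDl.
have [d d0 dP] := lebesgue_pt_right lf la eC.
have [ra ar'] : - r < a /\ a < r by apply/andP; rewrite -ltr_norml.
have r0 : 0 <= r by rewrite (le_trans _ (ltW ar)).
have fE y : `|y| <= r -> (u \_ `[- r, r]) y = u y.
  by move=> yr; rewrite patchE ifT//; apply/mem_set; rewrite /= in_itv/= -ler_norml.
near=> n.
have [k kE] : exists k : R, k = n.+1%:R by eexists.
rewrite -kE.
have k0 : 0 < k by rewrite kE ltr0n.
have kV0 : 0 < k^-1 by rewrite invr_gt0.
have kV s : 0 < s -> (n%:R >= s^-1) -> k^-1 < s.
  move=> s0 sn; rewrite invf_plt ?posrE// (le_lt_trans sn)// kE ltr_nat//.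
have kd : k^-1 < d by apply: kV => //; near: n; exact: nbhs_infty_ger.
have kr : k^-1 < r - a.
  by apply: kV; [lra|near: n; exact: nbhs_infty_ger].
pose h y := k * derive1 sigma (k * y + - (k * a)).
have ch : cont_on l h by move=> y _; exact: ramp'_cont.
have hl := cont_on_locint ch.
have h1 : \int[mu]_(y in `[- r, r]) h y = 1.
  have rr : `|- r| < l by rewrite normrN ger0_norm.
  rewrite -oint_leE; last lra.
  have rr' : `|r| < l by rewrite ger0_norm.
  rewrite (oint_FTC2 (fun x _ => ramp_is_derive k a x) ch rr rr').
  rewrite (ramp_eq0 (ltW k0) (ltW ra)).
  by rewrite ramp_eq1 ?subr0// -ler_pdivrMl// mulr1 ltW.
have -> : u a = \int[mu]_(y in `[- r, r]) (u a * h y).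
  by rewrite RintegralZl ?h1 ?mulr1//; exact: locint_cc rl.
have i1 : mu.-integrable `[- r, r] (EFin \o (fun y => u a * h y)).
  exact: locint_cc (locintZ _ hl) rl.
have i2 : mu.-integrable `[- r, r] (EFin \o (fun y => u y * h y)).
  exact: locint_cc (locint_mul_cont_on ul ch) rl.
have l3 : locally_integrable (open_itv l) (fun y => u a * h y - u y * h y).
  by apply: locally_integrableB; [exact: locintZ|exact: locint_mul_cont_on].
have l4 : locally_integrable (open_itv l) (fun y => u y - u a).
  by apply: locally_integrableB => //; exact: locint_cst.
have al : `|a| < l by exact: lt_trans rl.
have akl : `|a + k^-1| < l by rewrite ltr_norml; apply/andP; split; lra.
rewrite -RintegralB//.
apply: le_trans (le_normr_Rintegral _ (locint_cc l3 rl)) _ => //.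
have sub : `[a, a + k^-1] `<=` `[- r, r].
  by move=> y /=; rewrite !in_itv/= => /andP[? ?]; apply/andP; split; lra.
rewrite (Rint_shrink sub); last first.
  move=> y _ /negP; rewrite /= in_itv/= => yk.
  by rewrite /h ramp'_eq0// !mulr0 subrr normr0.
have i4 := integrable_norm (locint_itv l4 al akl).
apply: (@le_trans _ _ (\int[mu]_(y in `[a, a + k^-1]) (k * C * `|u y - u a|))).
  apply: le_Rintegral => //.
  - exact: integrable_norm (locint_itv l3 al akl).
  - have : mu.-integrable `[a, a + k^-1] (fun y => (k * C)%:E * (`|u y - u a|)%:E)%E.
      by apply: integrableZl; [exact: measurable_itv|exact: i4].
    by [].
  - move=> y _; rewrite -mulrBl normrM distrC mulrC ler_wpM2r//.
    by rewrite /h normrM gtr0_norm// ler_wpM2l// ltW.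
rewrite RintegralZl//.
have -> : \int[mu]_(y in `[a, a + k^-1]) `|u y - u a| =
    \int[mu]_(y in `[a, a + k^-1]) `|(u \_ `[- r, r]) y - (u \_ `[- r, r]) a|.
  apply: eq_Rintegral => y /set_mem /sub; rewrite /= in_itv/= -ler_norml => yr.
  by rewrite !fE// ltW.
apply: (@le_trans _ _ (k * C * (e / (C + 1) * k^-1))).
  by rewrite ler_wpM2l ?dP// mulr_ge0// ltW.
have -> : k * C * (e / (C + 1) * k^-1) = e * (C / (C + 1)).
  by field; rewrite !gt_eqF// ltr_wpDl.
by rewrite ler_piMr ?(ltW e0)// ler_pdivrMr ?ltr_wpDl//; lra.
Unshelve. all: by end_near. Qed.

(** Dominated convergence with bound [|g|]. Each ramp vanishes at its own foot, so the differences
    tend at every point to the indicator of ]a, b]. *)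
Lemma ramp_cvg l r g a b : locally_integrable (open_itv l) g -> r < l ->
  `|a| < r -> `|b| < r -> a < b ->
  \int[mu]_(y in `[- r, r]) (g y * (ramp n.+1%:R a y - ramp n.+1%:R b y))
   @[n --> \oo] --> oint a b g.
Proof.
move=> gl rl ar br ab; have gr := locint_cc gl rl.
have mI : measurable (`[- r, r]%classic : set R) by exact: measurable_itv.
have mg : measurable_fun `[- r, r] g.
  by apply/measurable_EFinP; exact: measurable_int gr.
have mr k c : measurable_fun `[- r, r] (ramp k c).
  by apply: measurable_funTS; apply: continuous_measurable_fun; exact: (ramp_smooth k c 0).
have E : oint a b g = \int[mu]_(y in `[- r, r]) (g \_ `]a, b]) y.
  rewrite oint_leE ?(ltW ab)// -Rintegral_itv_obnd_cbnd; last first.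
    apply: (integrableS _ _ _ gr); [exact: measurable_itv..|].
    by apply: subset_trans (sub_itv_cc (ltW ar) (ltW br)); exact: subset_itv_oc_cc.
  rewrite -Rintegral_mkcondr; congr Rintegral; rewrite setIidr//.
  by apply: subset_trans (sub_itv_cc (ltW ar) (ltW br)); exact: subset_itv_oc_cc.
rewrite E /Rintegral.
have mgab : measurable_fun `]a, b] g.
  apply: measurable_funS mg => //.
  by apply: subset_trans (sub_itv_cc (ltW ar) (ltW br)); exact: subset_itv_oc_cc.
have mgabT : measurable_fun `[- r, r] (g \_ `]a, b]).
  by apply: measurable_funTS; apply/(measurable_restrictT _ _).1 => //; exact: measurable_itv.
have [||||| ia _ ] := @dominated_convergence _ _ _ mu _ mI
  (fun n y => (g y * (ramp n.+1%:R a y - ramp n.+1%:R b y))%:E)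
  (fun y => ((g \_ `]a, b]) y)%:E) (fun y => (`|g y|)%:E).
- move=> n; apply/measurable_EFinP; apply: measurable_funM => //.
  by apply: measurable_funB; exact: mr.
- exact/measurable_EFinP.
- apply: aeW => y yr; apply: cvg_near_cst; rewrite patchE.
  have [ya|ay] := leP y a.
    near=> n; rewrite !ramp_eq0// ?subrr ?mulr0 ?ifF//; last by lra.
    by apply/negP => /set_mem/=; rewrite in_itv/= ltNge ya.
  have [yb|yb] := leP y b.
    rewrite ifT; last by apply/mem_set; rewrite /= in_itv/= ay yb.
    by near=> n; rewrite (@ramp_eq0 _ b)// subr0 (near (ramp_cvg1 ay) n)// mulr1.
  rewrite ifF; last first.
    by apply/negP => /set_mem/=; rewrite in_itv/= ay leNgt yb.
  near=> n; rewrite (near (ramp_cvg1 ay) n)// (near (ramp_cvg1 yb) n)//.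
  by rewrite subrr mulr0.
- exact: integrable_norm.
- apply: aeW => y n yr /=; rewrite lee_fin normrM ler_piMr//.
  exact: ramp_norm_le1.
- move=> H; apply: fine_cvg; rewrite fineK; first exact: H.
  exact: integrable_fin_num ia.
Unshelve. all: by end_near. Qed.

(** The test functions are the differences [ramp k a - ramp k b]: as [k] grows, the integral with
    [u] tends to [u a - u b] and the one with [g] to [oint a b g]. *)
Lemma weak_derivative_increment l r u g a b :
  weak_derivative (open_itv l) u g -> r < l ->
  lebesgue_pt (u \_ `[- r, r]) a -> lebesgue_pt (u \_ `[- r, r]) b ->
  `|a| < r -> `|b| < r -> u b - u a = oint a b g.
Proof.
move=> wug rl; have [ul gl ug] := wug.
wlog ab : a b / a < b.
  move=> H la lb ar br; have [ab|ba|->] := ltgtP a b; first exact: H.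
    by rewrite oint_swap -(H b a)// opprB.
  by rewrite oint0 subrr.
move=> la lb ar br.
have S0 : 0 < r - b by move: br; rewrite ltr_norml subr_gt0 => /andP[].
have Ca := ramp'_cvg ul rl la ar; have Cb := ramp'_cvg ul rl lb br.
have Cg := ramp_cvg gl rl ar br ab.
have : - oint a b g = u a - u b; last by move/eqP; rewrite eqr_oppLR opprB => /eqP.
apply: (@cvg_unique _ (@Rhausdorff R) _ _ _ _ (cvgN Cg)).
apply: cvg_trans (cvgB Ca Cb); apply: near_eq_cvg; near=> n.
have [k kE] : exists k : R, k = n.+1%:R by eexists.
have k0 : 0 < k by rewrite kE ltr0n.
have kr : b + k^-1 < r.
  rewrite kE -ltrBrDl invf_plt ?posrE//.
  apply: (@le_lt_trans _ _ n%:R); last by rewrite ltr_nat.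
  by near: n; exact: nbhs_infty_ger.
have ra : - r < a by move: ar; rewrite ltr_norml => /andP[].
have sub : `[- r, r] `<=` open_itv l := sub_cc_open_itv rl.
have la' : - l < a by lra.
have bl' : b + k^-1 < l by exact: lt_trans rl.
have := ug _ (ramp_test_function k0 la' ab bl').
have D y : 'D_1 (fun y => ramp k a y - ramp k b y) y =
    k * derive1 sigma (k * y + - (k * a)) -
    k * derive1 sigma (k * y + - (k * b)).
  have := is_deriveB (ramp_is_derive k a y) (ramp_is_derive k b y).
  by move=> H; exact: (@derive_val _ _ _ _ _ _ _ H).
have kV : 0 < k^-1 by rewrite invr_gt0.
rewrite (Rint_shrink sub); last first.
  move=> y _; rewrite /= in_itv/= => /negP yr.
  rewrite D !ramp'_eq0 ?mulr0 ?subrr ?mulr0//.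
  - by apply: contra yr => /andP[? ?]; apply/andP; split; lra.
  - by apply: contra yr => /andP[? ?]; apply/andP; split; lra.
rewrite [in X in _ = - X](Rint_shrink sub); last first.
  move=> y _; rewrite /= in_itv/= => /negP yr.
  have /= := @ramp_support a b k k0 ab y.
  case: eqP => [->|_ /(_ isT)]; first by rewrite mulr0.
  by rewrite in_itv/= => yab; case/negP: yr; move: yab => /andP[? ?]; apply/andP; split; lra.
move=> /esym E; rewrite !fctE -kE E -RintegralB.
- by apply: eq_Rintegral => y _; rewrite D mulrBr.
- exact: measurable_itv.
- apply: locint_cc rl; apply: locint_mul_cont_on ul _ => y _; exact: ramp'_cont.
- apply: locint_cc rl; apply: locint_mul_cont_on ul _ => y _; exact: ramp'_cont.
Unshelve. all: by end_near. Qed.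

(** A null set cannot contain an interval of positive length. *)
Lemma ae_exists c r (P : R -> Prop) : 0 < r -> {ae mu, forall x, P x} ->
  exists2 x, `|x - c| < r & P x.
Proof.
move=> r0 [N [mN N0 PN]]; apply: contrapT => H.
have : `]c - r, c + r[ `<=` N.
  move=> x /=; rewrite in_itv/= -ltr_distl => xr; apply: PN => /= Px.
  by apply: H; exists x.
move=> /(le_measure mu (mem_set (measurable_itv _)) (mem_set mN)).
by rewrite /= N0 lebesgue_measure_itv/= lte_fin ifT ?lee_fin; lra.
Qed.

(** The point [0] need not be a Lebesgue point, so increments are taken from some Lebesgue point
    [x0], and the constant moves the base to [0]. *)
Lemma weak_derivative_primitive l r u g : weak_derivative (open_itv l) u g ->
  r < l -> exists c, {ae mu, forall x, `|x| < r -> u x = c + oint 0 x g}.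
Proof.
move=> wug rl; have [r0|r0] := leP r 0.
  exists 0; apply: aeW => x xr; have := normr_ge0 x; lra.
have [ul gl _] := wug.
have leb : {ae mu, forall x, lebesgue_pt (u \_ `[- r, r]) x}.
  apply: lebesgue_differentiation; apply: integrable_locally.
    exact: measurable_itv.
  exact: locint_cc rl.
have [x0] := ae_exists 0 r0 leb; rewrite subr0 => x0r lx0.
exists (u x0 - oint 0 x0 g); move: leb.
apply: filterS; first exact: (ae_filter_ringOfSetsType mu).
move=> x lx xr; have := weak_derivative_increment wug rl lx0 lx x0r xr.
have l0 : 0 < l by lra.
by rewrite (@oint_add _ l g x0 0 x) ?normr0 ?(lt_trans _ rl)// (oint_swap 0 x0); lra.
Qed.

End WeakDerivative.

(** * Primitives have a weak derivative *)

Section Converse.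
Context {R : realType}.
Local Notation mu := (@lebesgue_measure R).
Implicit Types (f g h u phi : R -> R) (x y r l : R).

Lemma test_function_is_derive (D : set R) phi x : test_function D phi ->
  is_derive x 1 phi ('D_1 phi x).
Proof. by move=> [/(_ [::]) [_ dphi] _ _]; apply: derivableP; exact: dphi. Qed.

Lemma test_function_continuous (D : set R) phi : test_function D phi ->
  continuous phi.
Proof. by move=> [/(_ [::]) [cphi _] _ _]. Qed.

Lemma test_function_derive_continuous (D : set R) phi : test_function D phi ->
  continuous (fun x => 'D_1 phi x).
Proof. by move=> [/(_ [:: 1]) [cphi _] _ _]. Qed.

Lemma derive_support phi x : ~ closure [set y | phi y != 0] x ->
  'D_1 phi x = 0.
Proof.
move=> nx; have : \forall y \near x, phi y = 0.
  have : open (~` closure [set y | phi y != 0]).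
    by apply: closed_openC; exact: closed_closure.
  move=> oC; have : nbhs x (~` closure [set y | phi y != 0]).
    by apply: open_nbhs_nbhs; split; [exact: oC|exact: nx].
  apply: filterS => y {}nx; apply/eqP; apply: contrapT => /negP py; apply: nx.
  exact: (@subset_closure _ [set z | phi z != 0] _ py).
move=> near0; have H : is_derive x 1 phi 0.
  apply: near_eq_is_derive (is_derive_cst (0 : R) x 1).
  by apply: filterS near0 => y ->.
exact: (@derive_val _ _ _ _ _ _ _ H).
Qed.

(** With a continuous [h], the product of the primitive and a test function is classically
    differentiable, and it vanishes at [- r] and [r], which lie outside the support. The constant
    and [h] may depend on [r], since a test function only sees one compact interval. *)
Lemma weak_derivative_of_primitive l u g : 0 < l ->
  locally_integrable (open_itv l) u -> locally_integrable (open_itv l) g ->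
  (forall r, 0 < r -> r < l -> exists c, exists2 h, cont_on l h &
    {ae mu, forall x, `|x| < r -> u x = c + oint 0 x h /\ g x = h x}) ->
  weak_derivative (open_itv l) u g.
Proof.
move=> l0 ul gl ug; split => // phi tphi.
have [_ cK KI] := tphi; set K := closure _ in cK KI.
have [r [r0 rl Kr]] := compact_sub_open_itv l0 cK KI.
have Krr x : K x -> `|x| < r by move=> /Kr /=; rewrite in_itv/= ltr_norml.
(* The equality almost everywhere is given on open balls; a radius [s] above [r] puts the endpoints
   [- r] and [r] inside. *)
pose s := (r + l) / 2; have [rs sl] : r < s /\ s < l by split; rewrite /s; lra.
have [c [h ch aeh]] := ug s (lt_trans r0 rs) sl.
have phi0 x : ~ K x -> phi x = 0.
  move=> nx; apply/eqP; apply: contrapT => /negP py; apply: nx.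
  exact: (@subset_closure _ [set z | phi z != 0] _ py).
have sub : `[- r, r] `<=` open_itv l := sub_cc_open_itv rl.
have nK x : ~ `[- r, r]%classic x -> ~ K x.
  move=> nx /Krr xr; apply: nx; rewrite /= in_itv/= -ler_norml; exact: ltW.
rewrite (Rint_shrink sub); last first.
  by move=> x _ /nK nx; rewrite derive_support// mulr0.
rewrite [in RHS](Rint_shrink sub); last first.
  by move=> x _ /nK nx; rewrite phi0// mulr0.
have rr : - r <= r by lra.
rewrite -!oint_leE//.
have hl := cont_on_locint ch.
have l0' : `|0 : R| < l by rewrite normr0.
pose G x := c + oint 0 x h.
have dG x : `|x| < l -> is_derive x 1 G (h x).
  move=> xl; have := is_deriveD (is_derive_cst c x 1)
    (oint_is_derive hl (ch x xl) l0' xl).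
  by rewrite add0r.
have cG := cont_on_is_derive dG.
have cphi : cont_on l phi by move=> x _; exact: test_function_continuous tphi x.
have cdphi : cont_on l (fun x => 'D_1 phi x).
  by move=> x _; exact: test_function_derive_continuous tphi x.
have Nrs : `|- r| < s by rewrite normrN gtr0_norm.
have rs' : `|r| < s by rewrite gtr0_norm.
rewrite (@ae_eq_oint _ l s _ (fun x => G x * 'D_1 phi x))//; last first.
- move: aeh; apply: filterS; first exact: (ae_filter_ringOfSetsType mu).
  by move=> x + xs => /(_ xs)[-> _].
- exact: locint_mul_cont_on (cont_on_locint cG) cdphi.
- exact: locint_mul_cont_on ul cdphi.
rewrite [in RHS](@ae_eq_oint _ l s _ (fun x => h x * phi x))//; last first.
- move: aeh; apply: filterS; first exact: (ae_filter_ringOfSetsType mu).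
  by move=> x + xs => /(_ xs)[_ ->].
- exact: locint_mul_cont_on hl cphi.
- exact: locint_mul_cont_on gl cphi.
have cGd : cont_on l (fun x => G x * 'D_1 phi x).
  by move=> x xl; apply: cvgM; [exact: cG|exact: cdphi].
have chp : cont_on l (fun x => h x * phi x).
  by move=> x xl; apply: cvgM; [exact: ch|exact: cphi].
have dF x : `|x| < l -> is_derive x 1 (fun x => G x * phi x)
    (G x * 'D_1 phi x + h x * phi x).
  move=> xl; have := is_deriveM (dG x xl) (test_function_is_derive x tphi).
  by rewrite /GRing.scale/= [phi x * _]mulrC.
have cF : cont_on l (fun x => G x * 'D_1 phi x + h x * phi x).
  by move=> x xl; apply: cvgD; [exact: cGd|exact: chp].
have Nrl := lt_trans Nrs sl; have rl' := lt_trans rs' sl.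
have := oint_FTC2 dF cF Nrl rl'.
rewrite (ointD (cont_on_locint cGd) (cont_on_locint chp))//.
rewrite !phi0; [by rewrite !mulr0 subrr => /eqP; rewrite addr_eq0 => /eqP|..].
- by move=> /Krr; rewrite normrN gtr0_norm// ltxx.
- by move=> /Krr; rewrite gtr0_norm// ltxx.
Qed.

End Converse.

(** * Linear systems of integral equations *)

Section System.
Context {R : realType}.
Local Notation mu := (@lebesgue_measure R).
Implicit Types (f g h u : R -> R) (x y r l : R).

Lemma is_derive_subst f x (a b : R) : is_derive x 1 f a -> a = b ->
  is_derive x 1 f b.
Proof. by move=> ? <-. Qed.

(** If they differed at one point they would differ on a whole neighbourhood, which a set of full
    measure must meet. *)
Lemma ae_eq_cont_on r f g : cont_on r f -> cont_on r g ->
  {ae mu, forall x, `|x| < r -> f x = g x} -> forall x, `|x| < r -> f x = g x.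
Proof.
move=> cf cg fg x xr; apply/eqP; rewrite -subr_eq0; apply: contrapT => /negP d0.
have := cont_onB cf cg xr; rewrite /prop_for /continuous_at.
move=> /cvgrPdist_lt /(_ `|f x - g x|); rewrite normr_gt0 => /(_ d0) near1.
have [e /= e0 He] : \forall t \near x,
    `|f x - g x - (f t - g t)| < `|f x - g x| /\ `|t| < r.
  by apply: filterS2 near1 (near_norm_lt xr).
have [t tx fgt] := ae_exists x e0 fg.
have [] := He t; first by rewrite /ball_/= distrC.
by move=> + tr; rewrite fgt// subrr subr0 ltxx.
Qed.

Lemma weak_derivative_cont l u g h : 0 < l -> weak_derivative (open_itv l) u g ->
  cont_on l u -> cont_on l h -> {ae mu, forall x, `|x| < l -> g x = h x} ->
  forall x, `|x| < l -> u x = u 0 + oint 0 x h.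
Proof.
move=> l0 wug cu ch gh x xl; have [ul gl _] := wug.
pose r := (`|x| + l) / 2.
have [xr rl] : `|x| < r /\ r < l by split; rewrite /r; lra.
have r0 : 0 < r by rewrite (le_lt_trans _ xr).
have [c uc] := weak_derivative_primitive wug rl.
have hl := cont_on_locint ch.
have o0 (s : R) : 0 < s -> `|0 : R| < s by rewrite normr0.
have E : forall t, `|t| < r -> u t = c + oint 0 t h.
  apply: ae_eq_cont_on.
  - exact: cont_onS (ltW rl) cu.
  - apply: cont_onD; first exact: cont_on_cst.
    exact: cont_onS (ltW rl) (oint_cont hl (o0 _ l0)).
  - have gh' : {ae mu, forall x, `|x| < r -> g x = h x}.
      move: gh; apply: filterS; first exact: (ae_filter_ringOfSetsType mu).
      by move=> t + tr; apply; exact: lt_trans rl.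
    move: uc; apply: filterS; first exact: (ae_filter_ringOfSetsType mu).
    by move=> t + tr => /(_ tr) ->; rewrite (ae_eq_oint gl hl rl gh' (o0 _ r0) tr).
by rewrite E// [in RHS]E ?o0// oint0 addr0.
Qed.

(** Uniqueness for d' = p y, y' = q d with zero data. The energy N = d^2 + y^2 has N' = 2 (p + q) d
    y, so |N'| <= M N where [M] bounds |p + q|. Hence N e^{-M t} is nonincreasing to the right of
    [0], N e^{M t} is nondecreasing to the left, and both vanish at [0]. *)
Lemma gronwall_system l (d y p q : R -> R) : 0 < l ->
  cont_on l d -> cont_on l y -> cont_on l p -> cont_on l q ->
  (forall x, `|x| < l -> d x = oint 0 x (fun t => p t * y t)) ->
  (forall x, `|x| < l -> y x = oint 0 x (fun t => q t * d t)) ->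
  forall x, `|x| < l -> y x = 0.
Proof.
move=> l0 cd cy cp cq dE yE.
have o0 : `|0 : R| < l by rewrite normr0.
have der (u v : R -> R) : cont_on l v ->
    (forall x, `|x| < l -> u x = oint 0 x v) ->
    forall x, `|x| < l -> is_derive x 1 u (v x).
  move=> cv uE x xl.
  apply: near_eq_is_derive (oint_is_derive (cont_on_locint cv) (cv x xl) o0 xl).
  by apply: filterS (near_norm_lt xl) => t tl; rewrite uE.
have dd := der _ _ (cont_onM cp cy) dE; have dy := der _ _ (cont_onM cq cd) yE.
pose N t := d t * d t + y t * y t.
pose N' t := 2 * (p t + q t) * (d t * y t).
have dN x : `|x| < l -> is_derive x 1 N (N' x).
  move=> xl; have [dx yx] := (dd x xl, dy x xl).
  have := is_deriveD (is_deriveM dx dx) (is_deriveM yx yx).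
  by move=> /is_derive_subst; apply; rewrite /N' /GRing.scale/=; ring.
have dNE (k x : R) : `|x| < l ->
    is_derive x 1 (fun t => N t * expR (k * t)) ((N' x + k * N x) * expR (k * x)).
  move=> xl; have dk := is_deriveZ k (is_derive_id x 1).
  have := is_deriveM (dN x xl)
    (@is_derive1_comp _ _ (fun t => k * t) _ _ _ (is_derive_expR _) dk).
  by move=> /is_derive_subst; apply; rewrite /GRing.scale/=; ring.
move=> x xl; have cpq := cont_onD cp cq.
have [M M0 pqM] := cont_on_bounded cpq xl.
have N'M t : `|t| <= `|x| -> `|N' t| <= M * N t.
  move=> tx; rewrite /N' [2 * _]mulrC -mulrA normrM ler_pM// ?pqM//.
  have := sqr_ge0 (d t + y t); have := sqr_ge0 (d t - y t); rewrite /N => ? ?.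
  by rewrite ler_norml; apply/andP; split; lra.
have N0 : N 0 = 0.
  by rewrite /N dE// yE// !oint0 mul0r addr0.
suff Nx : N x <= 0.
  have : y x * y x <= 0 by apply: le_trans Nx; rewrite lerDr -expr2 sqr_ge0.
  by move=> yx; apply/eqP; rewrite -sqrf_eq0 expr2 eq_le yx -expr2 sqr_ge0.
have cNE k (u v : R) : `|u| < l -> `|v| < l ->
    {within `[u, v], continuous (fun t => N t * expR (k * t))}.
  by apply: cont_on_withinS; exact: cont_on_is_derive (dNE k).
have [x0|x0|x0] := ltgtP x 0; last by rewrite x0 N0.
- have itl t : t \in `]x, 0[ -> `|t| <= `|x|.
    by rewrite in_itv/= => /andP[? ?]; rewrite !ltr0_norm//; lra.
  have [t tx] := MVT x0
    (fun t tx => dNE M t (le_lt_trans (itl t tx) xl)) (cNE M _ _ xl o0).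
  rewrite N0 mul0r sub0r sub0r => H.
  have : 0 <= (N' t + M * N t) * expR (M * t) * - x.
    apply: mulr_ge0; last lra.
    apply: mulr_ge0; last exact: expR_ge0.
    by have := N'M t (itl t tx); rewrite ler_norml => /andP[]; lra.
  by rewrite -H oppr_ge0 pmulr_lle0// expR_gt0.
- have itl t : t \in `]0, x[ -> `|t| <= `|x|.
    by rewrite in_itv/= => /andP[? ?]; rewrite !gtr0_norm//; lra.
  have [t tx] := MVT x0
    (fun t tx => dNE (- M) t (le_lt_trans (itl t tx) xl)) (cNE (- M) _ _ o0 xl).
  rewrite N0 mul0r !subr0 => H.
  have : (N' t + - M * N t) * expR (- M * t) * x <= 0.
    apply: mulr_le0_ge0; last exact: ltW.
    apply: mulr_le0_ge0; last exact: expR_ge0.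
    by have := N'M t (itl t tx); rewrite ler_norml => /andP[]; lra.
  by rewrite -H pmulr_lle0// expR_gt0.
Qed.

(** Primes mark the companion system, that of 1/a, and not derivatives; there [p] and [q] are
    exchanged. The combinations [e + k^-1 * z'] and [z + k * e'] start at 0 and solve a homogeneous
    system, so the second one vanishes, and [z = - k * e'] turns the equation for [e] into the
    claim. *)
Lemma dual_system l (p q e z e' z' : R -> R) (k c : R) : 0 < l -> 0 < k ->
  cont_on l p -> cont_on l q -> cont_on l e -> cont_on l z ->
  cont_on l e' -> cont_on l z' ->
  (forall x, `|x| < l -> e x = c + oint 0 x (fun t => p t * z t)) ->
  (forall x, `|x| < l ->
     z x = - (k * c) + oint 0 x (fun t => k ^+ 2 * (q t * e t))) ->
  (forall x, `|x| < l -> e' x = c + oint 0 x (fun t => q t * z' t)) ->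
  (forall x, `|x| < l ->
     z' x = - (k * c) + oint 0 x (fun t => k ^+ 2 * (p t * e' t))) ->
  forall x, `|x| < l -> e x = c - k * oint 0 x (fun t => p t * e' t).
Proof.
move=> l0 k0 cp cq ce cz ce' cz' eE zE e'E z'E.
have o0 : `|0 : R| < l by rewrite normr0.
have L f g : cont_on l f -> cont_on l g ->
    locally_integrable (open_itv l) (fun t => f t * g t).
  by move=> cf cg; exact: cont_on_locint (cont_onM cf cg).
have k0' : k != 0 by rewrite gt_eqF.
have H := @gronwall_system l (fun t => e t + k^-1 * z' t) (fun t => z t + k * e' t)
  p (fun t => k ^+ 2 * q t) l0 _ _ cp _ _ _.
have {H} Y0 : forall x, `|x| < l -> z x + k * e' x = 0.
  apply: H.
  - exact/(cont_onD ce)/cont_onZ.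
  - exact/(cont_onD cz)/cont_onZ.
  - exact: cont_onZ.
  - move=> x xl.
    rewrite (_ : (fun t => _) = fun t => p t * z t + k * (p t * e' t)).
      2: by apply/funext => t; ring.
    rewrite (ointD _ _ o0 xl); [|exact: L|exact/locintZ/L].
    rewrite (ointZ k _ o0 xl); last exact: L.
    rewrite eE// z'E// (ointZ _ _ o0 xl); last exact: L.
    by field.
  - move=> x xl; rewrite (_ : (fun t => _) =
        fun t => k ^+ 2 * (q t * e t) + k * (q t * z' t)).
      2: by apply/funext => t; field.
    rewrite (ointD _ _ o0 xl); [|exact/locintZ/L|exact/locintZ/L].
    rewrite [oint 0 x (fun t => k * _)](ointZ k _ o0 xl); last exact: L.
    by rewrite zE// e'E//; ring.
move=> x xl; rewrite eE//; congr (_ + _).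
rewrite -mulNr -(ointZ _ _ o0 xl); last exact: L.
apply: (@eq_oint _ `|x|); rewrite ?normr0// => t tx.
have := Y0 t (le_lt_trans tx xl) => /eqP; rewrite addr_eq0 => /eqP ->; ring.
Qed.

End System.

(** * Integrals against a continuous kernel *)

Section Kernel.
Context {R : realType}.
Local Notation mu := (@lebesgue_measure R).
Implicit Types (f g h u w : R -> R) (x y r l : R) (K : R * R -> R).

Definition cont2_on l K := forall x t : R, `|x| < l -> `|t| < l ->
  {for (x, t), continuous K}.

(** The integral term of T for a real kernel, [w] standing for u'. *)
Definition tint K w x := oint (- x) x (fun t => K (x, t) * w t).

Lemma cont2_row l K x : cont2_on l K -> `|x| < l ->
  cont_on l (fun t => K (x, t)).
Proof.
move=> cK xl t tl; apply: (@continuous_comp _ _ _ (fun t => (x, t)) K); last exact: cK.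
by apply: (@cvg_pair _ _ _ _ (nbhs x) (nbhs t)); [exact: cvg_cst|exact: cvg_id].
Qed.

Lemma cont2_col l K t : cont2_on l K -> `|t| < l ->
  cont_on l (fun x => K (x, t)).
Proof.
move=> cK tl x xl; apply: (@continuous_comp _ _ _ (fun x => (x, t)) K); last exact: cK.
by apply: (@cvg_pair _ _ _ _ (nbhs x) (nbhs t)); [exact: cvg_id|exact: cvg_cst].
Qed.

Lemma cont2_bounded l K r : cont2_on l K -> r < l ->
  exists2 M, 0 <= M & forall x t : R, `|x| <= r -> `|t| <= r -> `|K (x, t)| <= M.
Proof.
move=> cK rl; pose S : set (R * R) := `[- r, r]%classic `*` `[- r, r]%classic.
have cS : compact S by apply: compact_setX; exact: segment_compact.
have cw : {within S, continuous K}.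
  apply/subspace_continuousP => -[x t] [/= xr tr].
  apply: cvg_within_filter; apply: cK.
  - by move: xr; rewrite in_itv/= -ler_norml => /le_lt_trans; exact.
  - by move: tr; rewrite in_itv/= -ler_norml => /le_lt_trans; exact.
have /compact_bounded[M [_ KM]] := continuous_compact cw cS.
exists (`|M| + 1) => [|x t xr tr]; first by rewrite addr_ge0.
apply: (KM (`|M| + 1)); first by rewrite (le_lt_trans (ler_norm _))// ltrDl.
by exists (x, t) => //; split; rewrite /= in_itv/= -ler_norml.
Qed.

Lemma tint_locint l K w x : cont2_on l K -> locally_integrable (open_itv l) w ->
  `|x| < l -> locally_integrable (open_itv l) (fun t => K (x, t) * w t).
Proof. by move=> cK wl xl; apply: cont_on_mul_locint => //; exact: cont2_row. Qed.

(** The point enters through the limits and through the kernel. [F] moves the limits with the kernel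
    frozen at [x0]; [G], the L^1 distance between the integrands on a fixed interval, is continuous
    by dominated convergence with bound [2 * M * |w|] and vanishes at [x0]. *)
Lemma tint_cont l K w : cont2_on l K -> locally_integrable (open_itv l) w ->
  cont_on l (tint K w).
Proof.
move=> cK wl x0 x0l; pose r := (`|x0| + l) / 2.
have [x0r rl] : `|x0| < r /\ r < l by split; rewrite /r; lra.
have r0 : 0 < r by rewrite (le_lt_trans _ x0r).
have o0 : `|0 : R| < l by rewrite normr0 (lt_trans r0).
have [M M0 KM] := cont2_bounded cK rl.
pose h x t := K (x, t) * w t.
have hl x : `|x| < l -> locally_integrable (open_itv l) (h x).
  by move=> xl; exact: tint_locint.
pose D x t := `|h x t - h x0 t|.
pose G x := \int[mu]_(t in `[- r, r]) D x t.
have Dx0 : G x0 = 0.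
  rewrite /G; under eq_Rintegral do rewrite /D subrr normr0.
  by rewrite Rintegral_cst ?mul0r//; exact: measurable_itv.
have xI x : `]- r, r[%classic x -> `|x| < r by rewrite /= in_itv/= -ltr_norml.
have Dint x : `|x| < r -> mu.-integrable `[- r, r] (EFin \o D x).
  move=> xr; apply: integrable_norm; apply: (locint_cc _ rl).
  by apply: locally_integrableB; apply: hl => //; exact: lt_trans rl.
have cG : {for x0, continuous G}.
  have mI : measurable (`[- r, r]%classic : set R) by exact: measurable_itv.
  apply: (@continuity_under_integral _ _ _ mu D _ mI (- r) r _ _
     (fun t => 2 * M * `|w t|)).
  - by move=> x /xI; exact: Dint.
  - apply: aeW => t; rewrite /= in_itv/= -ler_norml => tr x /set_mem/xI xr.
    have tl : `|t| < l by exact: le_lt_trans rl.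
    rewrite /D /h; apply: (@continuous_comp _ _ _
      (fun x => K (x, t) * w t - K (x0, t) * w t) Num.Def.normr).
      apply: cvgB; last exact: cvg_cst.
      apply: cvgM; last exact: cvg_cst.
      by apply: (cont2_col cK tl); exact: lt_trans rl.
    exact: norm_continuous.
  - have : mu.-integrable `[- r, r] (fun t => (2 * M)%:E * (`|w t|)%:E)%E.
      apply: integrableZl; first exact: measurable_itv.
      exact: integrable_norm (locint_cc wl rl).
    by [].
  - move=> x /xI xr; apply: aeW => t; rewrite /= in_itv/= -ler_norml => tr.
    rewrite /D normr_id /h -mulrBl normrM ler_wpM2r//.
    rewrite (le_trans (ler_normB _ _))// mulr_natl mulr2n lerD// KM//; exact: ltW.
  - by rewrite inE /= in_itv/= -ltr_norml.
pose F x := oint 0 x (h x0) - oint 0 (- x) (h x0).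
have cF : {for x0, continuous F}.
  apply: cvgB; first exact: (oint_cont (hl _ x0l) o0).
  apply: (@continuous_comp _ _ _ (fun x => - x) (fun x => oint 0 x (h x0))).
    by apply: cvgN; exact: cvg_id.
  by apply: (oint_cont (hl _ x0l) o0); rewrite normrN.
have FE x : `|x| < l -> F x = oint (- x) x (h x0).
  move=> xl; rewrite /F (@oint_add _ l (h x0) (- x) 0 x)// ?normrN//; last exact: hl.
  by rewrite (oint_swap 0 (- x)) addrC.
apply/cvgrPdist_lt => e e0.
have e2 : 0 < e / 2 by rewrite divr_gt0.
move: cF cG => /cvgrPdist_lt /(_ _ e2) nF /cvgrPdist_lt /(_ _ e2) nG.
apply: filterS3 nF nG (near_norm_lt x0r) => x xF xG xr.
have xl := lt_trans xr rl.
have Nxr : `|- x| <= r by rewrite normrN ltW.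
have xr' := ltW xr.
have -> : tint K w x0 - tint K w x =
    (F x0 - F x) - oint (- x) x (fun t => h x t - h x0 t).
  rewrite !FE// (ointB _ _ _ xl) ?normrN//; [|exact: hl..].
  by rewrite /tint /h; ring.
have H : `|oint (- x) x (fun t => h x t - h x0 t)| <= G x.
  apply: oint_norm_le => //.
  by apply: (locint_cc _ rl); apply: locally_integrableB; exact: hl.
move: xG; rewrite Dx0 sub0r normrN => xG.
have := ler_normB (F x0 - F x) (oint (- x) x (fun t => h x t - h x0 t)).
by have := ler_norm (G x); lra.
Qed.

End Kernel.

(** * Bernstein approximation *)

Section Bernstein.
Context {R : realType}.
Implicit Types (phi psi : nat -> R) (f : R -> R) (y : R).

(** For [y] in [0, 1], the expectation of [phi] at a binomial variable with parameters [n] and [y],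
    conditioned on one trial. With phi(k) = f(k/n) it is the Bernstein polynomial of f, free of
    binomial coefficients. *)
Fixpoint bern (n : nat) phi y : R :=
  if n is n'.+1 then y * bern n' (fun k => phi k.+1) y + (1 - y) * bern n' phi y
  else phi 0%N.

Lemma bern_continuous n phi : continuous (bern n phi).
Proof.
elim: n phi => [|n IH] phi y; first exact: cvg_cst.
apply: cvgD; apply: cvgM; [exact: cvg_id|exact: IH| |exact: IH].
by apply: cvgB; [exact: cvg_cst|exact: cvg_id].
Qed.

Lemma ler_bern n phi psi y : 0 <= y <= 1 ->
  (forall k, (k <= n)%N -> phi k <= psi k) -> bern n phi y <= bern n psi y.
Proof.
move=> y01; elim: n phi psi => [|n IH] phi psi pp /=; first exact: pp.
have /andP[y0 y1] := y01.
apply: lerD; apply: ler_wpM2l => //; last 2 first.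
- lra.
- by apply: IH => k kn; apply: pp; exact: leqW.
- by apply: IH => k kn; exact: pp.
Qed.

(* The mean and the variance of the binomial distribution, in one identity
   that is stable under the recursion. *)
Lemma bern_quadratic n (p q s : R) y :
  bern n (fun k => p + q * (k%:R - s) ^+ 2) y =
  p + q * (n%:R * y * (1 - y) + (n%:R * y - s) ^+ 2).
Proof.
elim: n s => [|n IH] s /=; first by ring.
have -> : (fun k : nat => p + q * (k.+1%:R - s) ^+ 2) =
    fun k => p + q * (k%:R - (s - 1)) ^+ 2.
  by apply/funext => k; rewrite -natr1; ring.
by rewrite !IH -natr1; ring.
Qed.

(** Uniform continuity in a form quadratic in [z], which [bern_quadratic] averages exactly. On the
    compact set of pairs with [|f z - f y| >= e], the square of [z - y] has a positive minimum; [D]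
    is the maximum of [|f z - f y|] there divided by this minimum. *)
Lemma quadratic_modulus f (e : R) : continuous f -> 0 < e ->
  exists2 D, 0 <= D & forall y z, 0 <= y <= 1 -> 0 <= z <= 1 ->
    `|f z - f y| <= e + D * (z - y) ^+ 2.
Proof.
move=> cf e0; pose S : set (R * R) := `[0, 1]%classic `*` `[0, 1]%classic.
pose d (p : R * R) := `|f p.2 - f p.1|.
have cS : compact S by apply: compact_setX; exact: segment_compact.
have cd : continuous d.
  move=> p.
  apply: (@continuous_comp _ _ _ (fun p : R * R => f p.2 - f p.1) Num.Def.normr).
    apply: cvgB.
      by apply: (@continuous_comp _ _ _ snd f); [exact: cvg_snd|exact: cf].
    by apply: (@continuous_comp _ _ _ fst f); [exact: cvg_fst|exact: cf].
  exact: norm_continuous.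
have cA : compact (S `&` [set p | e <= d p]).
  apply: (subclosed_compact _ cS) => [|p []//].
  apply: closedI; first exact: compact_closed.
  apply: (@closed_comp _ _ d [set t | e <= t]) => [p _|]; first exact: cd.
  exact: closed_ge.
have [A0|/set0P A0] := eqVneq (S `&` [set p | e <= d p]) set0.
  exists 0 => // y z y01 z01; rewrite mul0r addr0 leNgt; apply/negP => H.
  have : (S `&` [set p | e <= d p]) (y, z).
    by split; [split; rewrite /= in_itv/=|rewrite /d /= ltW].
  by rewrite A0.
pose q (p : R * R) := (p.2 - p.1) ^+ 2.
have cq : continuous q.
  have c1 : continuous (fun p : R * R => p.2 - p.1).
    by move=> p; apply: cvgB; [exact: cvg_snd|exact: cvg_fst].
  by move=> p; apply: cvgM; exact: c1.
have [m /set_mem Am mmin] := compact_EVT_min A0 cA (continuous_subspaceT cq).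
have [M Am' Mmax] := compact_EVT_max A0 cA (continuous_subspaceT cd).
have q0 : 0 < q m.
  rewrite lt_neqAle sqr_ge0 andbT eq_sym; apply/negP.
  rewrite sqrf_eq0 subr_eq0 => /eqP E.
  by case: Am => _; rewrite /= /d E subrr normr0 leNgt e0.
have dM0 : 0 <= d M / q m by apply: divr_ge0; [exact: normr_ge0|exact: ltW].
exists (d M / q m) => // y z y01 z01.
have [H|H] := leP e `|f z - f y|; last first.
  by rewrite (le_trans (ltW H))// lerDl mulr_ge0// sqr_ge0.
have A : (S `&` [set p | e <= d p]) (y, z).
  by split; [split; rewrite /= in_itv/=|].
rewrite ler_wpDl ?(ltW e0)//.
apply: (le_trans (Mmax (y, z) (mem_set A))).
rewrite mulrAC ler_pdivlMr//; apply: ler_wpM2l; first exact: normr_ge0.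
exact: (mmin (y, z) (mem_set A)).
Qed.

Lemma bern_approx f (e : R) : continuous f -> 0 < e ->
  exists n, forall y, 0 <= y <= 1 ->
    `|f y - bern n (fun k => f (k%:R / n%:R)) y| <= e.
Proof.
move=> cf e0; have e2 : 0 < e / 2 by rewrite divr_gt0.
have [D D0 fD] := quadratic_modulus cf e2.
(* The variance will contribute [D / n * (y * (1 - y))], so it is enough that [D / n <= e / 2]. *)
pose n := (Num.truncn (D / (e / 2))).+1.
have n0 : (0 : R) < n%:R by rewrite ltr0n.
have nD : D / n%:R <= e / 2.
  rewrite ler_pdivrMr// mulrC -ler_pdivrMr//; apply: ltW; exact: truncnS_gt.
exists n => y y01; have /andP[y0 y1] := y01.
pose q := D / n%:R ^+ 2.
have q0 : 0 <= q by rewrite divr_ge0// sqr_ge0.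
have fq k : (k <= n)%N ->
    `|f (k%:R / n%:R) - f y| <= e / 2 + q * (k%:R - n%:R * y) ^+ 2.
  move=> kn; have -> : q * (k%:R - n%:R * y) ^+ 2 = D * (k%:R / n%:R - y) ^+ 2.
    by rewrite /q; field; rewrite gt_eqF.
  by apply: fD => //; rewrite divr_ge0// ler_pdivrMr// mul1r ler_nat.
have qe : q * (n%:R * y * (1 - y)) <= e / 2.
  have -> : q * (n%:R * y * (1 - y)) = D / n%:R * (y * (1 - y)).
    by rewrite /q; field; rewrite gt_eqF.
  rewrite (le_trans _ nD)// ler_piMr ?divr_ge0//.
  nra.
(* Centring at the mean [n * y] removes the squared term and leaves the variance alone. *)
have B1 := bern_quadratic n (f y + e / 2) q (n%:R * y) y.
have B2 := bern_quadratic n (f y - e / 2) (- q) (n%:R * y) y.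
have U : bern n (fun k => f (k%:R / n%:R)) y <=
    bern n (fun k => f y + e / 2 + q * (k%:R - n%:R * y) ^+ 2) y.
  by apply: ler_bern => // k /fq; rewrite ler_norml => /andP[_]; lra.
have L : bern n (fun k => f y - e / 2 + - q * (k%:R - n%:R * y) ^+ 2) y <=
    bern n (fun k => f (k%:R / n%:R)) y.
  by apply: ler_bern => // k /fq; rewrite ler_norml => /andP[+ _]; lra.
rewrite distrC ler_norml; move: U L; rewrite B1 B2 subrr expr0n/= addr0.
by move=> U L; apply/andP; split; lra.
Qed.

End Bernstein.

(** * The identity for real functions *)

Section Transmutation.
Context {R : realType}.
Local Notation mu := (@lebesgue_measure R).
Implicit Types (f g h u w V : R -> R) (x y r l k : R) (K : R * R -> R).

Lemma tintD l K f g x : cont2_on l K ->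
  locally_integrable (open_itv l) f -> locally_integrable (open_itv l) g ->
  `|x| < l -> tint K (fun t => f t + g t) x = tint K f x + tint K g x.
Proof.
move=> cK fl gl xl; rewrite /tint -(@ointD _ l) ?normrN//; try exact: tint_locint.
by congr oint; apply/funext => t; rewrite mulrDr.
Qed.

Lemma tintZ l K c f x : cont2_on l K -> locally_integrable (open_itv l) f ->
  `|x| < l -> tint K (fun t => c * f t) x = c * tint K f x.
Proof.
move=> cK fl xl; rewrite /tint -(@ointZ _ l) ?normrN//; try exact: tint_locint.
by congr oint; apply/funext => t; rewrite mulrCA.
Qed.

Lemma eq_tint K f g x : (forall t, `|t| <= `|x| -> f t = g t) ->
  tint K f x = tint K g x.
Proof.
move=> fg; apply: (@eq_oint _ `|x|); rewrite ?normrN// => t tx.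
by rewrite fg.
Qed.

Lemma Rint_norm_mul_le l r (K : R -> R) w M : r < l ->
  locally_integrable (open_itv l) w ->
  locally_integrable (open_itv l) (fun t => K t * w t) ->
  (forall t, `|t| <= r -> `|K t| <= M) ->
  \int[mu]_(t in `[- r, r]) `|K t * w t| <= M * \int[mu]_(t in `[- r, r]) `|w t|.
Proof.
move=> rl wl Kwl KM; have iw := integrable_norm (locint_cc wl rl).
rewrite -RintegralZl//; apply: le_Rintegral => //.
- exact: integrable_norm (locint_cc Kwl rl).
- have : mu.-integrable `[- r, r] (fun t => M%:E * (`|w t|)%:E)%E.
    by apply: integrableZl => //; exact: measurable_itv.
  by [].
- move=> t; rewrite /= in_itv/= -ler_norml => tr.
  by rewrite normrM ler_wpM2r// KM.
Qed.

(** * The defect of the integrated identity as a functional of u'' *)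

Section Defect.
Variables (l : R) (alpha : R -> R) (c : R) (K K' : R * R -> R).
Hypotheses (l0 : 0 < l) (calpha : cont_on l alpha)
  (cK : cont2_on l K) (cK' : cont2_on l K').

(** With [alpha] = a^-2 and [c = 1], this is the integral from 0 to [x] of a^-2 times the
    transmutation of [V] by [K'], when V' = w. *)
Let source V w x : R := oint 0 x (fun s => alpha s * (c * V s - tint K' w s)).

(* [defect x V w] vanishes when the identity holds at [x] for a function whose
   first two derivatives are [V] and [w]; [c] is 1 for the real parts of the
   kernels and 0 for their imaginary parts. *)
Definition defect x V w : R := c * oint 0 x V - tint K V x - source V w x.

Let o0 : `|0 : R| < l. Proof. by rewrite normr0. Qed.

Let cont_rhs V w : cont_on l V -> locally_integrable (open_itv l) w ->
  cont_on l (fun s => alpha s * (c * V s - tint K' w s)).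
Proof.
move=> cV wl; apply: cont_onM => //; apply: cont_onB; first exact: cont_onZ.
exact: tint_cont.
Qed.

Let sourceD x V1 V2 w1 w2 : `|x| < l -> cont_on l V1 -> cont_on l V2 ->
  locally_integrable (open_itv l) w1 -> locally_integrable (open_itv l) w2 ->
  source (fun t => V1 t + V2 t) (fun t => w1 t + w2 t) x =
  source V1 w1 x + source V2 w2 x.
Proof.
move=> xl c1 c2 w1l w2l; rewrite /source.
rewrite -(ointD (cont_on_locint (cont_rhs c1 w1l))
  (cont_on_locint (cont_rhs c2 w2l)))//.
apply: (@eq_oint _ `|x|); rewrite ?normr0// => t tx.
rewrite (tintD cK' w1l w2l) ?(le_lt_trans tx)//.
by move: (tint K' w1 t) (tint K' w2 t) => *; ring.
Qed.

Let sourceZ x a V w : `|x| < l -> cont_on l V ->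
  locally_integrable (open_itv l) w ->
  source (fun t => a * V t) (fun t => a * w t) x = a * source V w x.
Proof.
move=> xl cV wl; rewrite /source -(ointZ a (cont_on_locint (cont_rhs cV wl)))//.
apply: (@eq_oint _ `|x|); rewrite ?normr0// => t tx.
rewrite (tintZ a cK' wl) ?(le_lt_trans tx)//.
by move: (tint K' w t) => *; ring.
Qed.

Let eq_source x V1 V2 w1 w2 :
  (forall t, `|t| <= `|x| -> V1 t = V2 t) ->
  (forall t, `|t| <= `|x| -> w1 t = w2 t) -> source V1 w1 x = source V2 w2 x.
Proof.
move=> V12 w12; apply: (@eq_oint _ `|x|); rewrite ?normr0// => t tx.
rewrite V12// (@eq_tint K' w1 w2)// => s st.
by apply: w12; exact: le_trans tx.
Qed.

Lemma defectD x V1 V2 w1 w2 : `|x| < l -> cont_on l V1 -> cont_on l V2 ->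
  locally_integrable (open_itv l) w1 -> locally_integrable (open_itv l) w2 ->
  defect x (fun t => V1 t + V2 t) (fun t => w1 t + w2 t) =
  defect x V1 w1 + defect x V2 w2.
Proof.
move=> xl c1 c2 w1l w2l; have l1 := cont_on_locint c1; have l2 := cont_on_locint c2.
rewrite /defect (ointD l1 l2)// (tintD cK l1 l2)// sourceD//.
move: (oint 0 x V1) (oint 0 x V2) (tint K V1 x) (tint K V2 x) (source V1 w1 x)
  (source V2 w2 x).
by move=> *; ring.
Qed.

Lemma defectZ x a V w : `|x| < l -> cont_on l V ->
  locally_integrable (open_itv l) w ->
  defect x (fun t => a * V t) (fun t => a * w t) = a * defect x V w.
Proof.
move=> xl cV wl; have Vl := cont_on_locint cV.
rewrite /defect (ointZ a Vl)// (tintZ a cK Vl)// sourceZ//.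
by move: (oint 0 x V) (tint K V x) (source V w x) => *; ring.
Qed.

Lemma eq_defect x V1 V2 w1 w2 :
  (forall t, `|t| <= `|x| -> V1 t = V2 t) ->
  (forall t, `|t| <= `|x| -> w1 t = w2 t) -> defect x V1 w1 = defect x V2 w2.
Proof.
move=> V12 w12; rewrite /defect (eq_tint _ V12) (eq_source V12 w12).
by rewrite (@eq_oint R `|x| V1 V2 0 x V12)// normr0.
Qed.

(** The part of the defect due to u'' alone, that is with u'(0) = 0. *)
Definition defect0 x w : R := defect x (fun t => oint 0 t w) w.

Lemma defect0D x w1 w2 : `|x| < l ->
  locally_integrable (open_itv l) w1 -> locally_integrable (open_itv l) w2 ->
  defect0 x (fun t => w1 t + w2 t) = defect0 x w1 + defect0 x w2.
Proof.
move=> xl w1l w2l; rewrite /defect0 -defectD//; try exact: oint_cont.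
by apply: eq_defect => // t tx; rewrite (ointD w1l w2l) ?(le_lt_trans tx).
Qed.

Lemma defect0Z x a w : `|x| < l -> locally_integrable (open_itv l) w ->
  defect0 x (fun t => a * w t) = a * defect0 x w.
Proof.
move=> xl wl; rewrite /defect0 -defectZ//; try exact: oint_cont.
by apply: eq_defect => // t tx; rewrite (ointZ _ wl) ?(le_lt_trans tx).
Qed.

Lemma eq_defect0 x w1 w2 : (forall t, `|t| <= `|x| -> w1 t = w2 t) ->
  defect0 x w1 = defect0 x w2.
Proof.
move=> w12; apply: eq_defect => // t tx.
apply: (@eq_oint _ `|t|); rewrite ?normr0// => s st.
by apply: w12; exact: le_trans tx.
Qed.

(** The L^1 norm [S] of [w] bounds its primitive. With the bounds of [alpha] and of the kernels on
    [- r, r] it controls the three terms of the defect, whose outer integrals run over a length at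
    most [2 * r]; [C] adds the three constants. *)
Lemma defect0_le x r : `|x| <= r -> r < l ->
  exists2 C, 0 <= C & forall w, locally_integrable (open_itv l) w ->
    `|defect0 x w| <= C * \int[mu]_(t in `[- r, r]) `|w t|.
Proof.
move=> xr rl; have r0 : 0 <= r by exact: le_trans xr.
have [M M0 KM] := cont2_bounded cK rl.
have [M' M'0 KM'] := cont2_bounded cK' rl.
have [A A0 aA] := cont_on_bounded calpha rl.
exists (`|c| * (2 * r) + M * (2 * r) + A * (`|c| + M') * (2 * r)).
  by rewrite !addr_ge0// !mulr_ge0// addr_ge0.
move=> w wl; set S := Rintegral _ _ _.
have xl := le_lt_trans xr rl.
have N0r : `|0 : R| <= r by rewrite normr0.
have Nxr : `|- x| <= r by rewrite normrN.
have cV := oint_cont wl o0; have Vl := cont_on_locint cV.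
have VS t : `|t| <= r -> `|oint 0 t w| <= S.
  by move=> tr; apply: oint_norm_le => //; exact: (locint_cc wl rl).
have S0 : 0 <= S by exact: le_trans (VS 0 N0r).
have e1 : `|oint 0 x (fun t => oint 0 t w)| <= S * (2 * r).
  exact: (oint_norm_cst Vl rl VS N0r xr).
have e2 : `|tint K (fun t => oint 0 t w) x| <= M * S * (2 * r).
  apply: (oint_norm_cst (tint_locint cK Vl xl) rl _ Nxr xr) => t tr.
  by rewrite normrM ler_pM// ?KM// VS.
have e3 : `|source (fun t => oint 0 t w) w x| <= A * (`|c| * S + M' * S) * (2 * r).
  apply: (oint_norm_cst (cont_on_locint (cont_rhs cV wl)) rl _ N0r xr) => t tr.
  rewrite normrM ler_pM// ?aA// (le_trans (ler_normB _ _))// lerD//.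
    by rewrite normrM ler_wpM2l// VS.
  have tl := le_lt_trans tr rl.
  have tw := tint_locint cK' wl tl.
  apply: le_trans (oint_norm_le (locint_cc tw rl) _ tr) _; first by rewrite normrN.
  by apply: (Rint_norm_mul_le rl wl tw) => s sr; exact: KM'.
rewrite /defect0 /defect.
apply: le_trans (ler_normB _ _) _; apply: le_trans (lerD (ler_normB _ _) e3) _.
rewrite normrM; have := ler_wpM2l (normr_ge0 c) e1; move: e2; set p := `|tint _ _ _|.
by set q := `|c| * `|_|; move=> e2 e1'; lra.
Qed.

(** At rho = i k the representation reads e_a = e^{-kx} + k int K e^{-kt}. The left side is
    therefore one part (real or imaginary) of e_a, and the factor of [alpha s] on the right is the
    same part of e_{1/a}. *)
Hypothesis exp_identity : forall k x, 0 < k -> `|x| < l ->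
  c * expR (- k * x) + k * tint K (fun t => expR (- k * t)) x =
  c - k * oint 0 x (fun s => alpha s *
    (c * expR (- k * s) + k * tint K' (fun t => expR (- k * t)) s)).

Let e k t : R := expR (- k * t).

Let e_is_derive k x : is_derive x 1 (e k) (- k * e k x).
Proof.
have := @is_derive1_comp _ _ (fun t => - k * t) _ _ _ (is_derive_expR _)
  (is_deriveZ (- k) (is_derive_id x 1)).
by move=> /is_derive_subst; apply; rewrite /e /GRing.scale/= mulr1 mulrC.
Qed.

Let e_cont k : cont_on l (e k).
Proof. by apply: cont_on_is_derive => x _; exact: e_is_derive. Qed.

Let e_locint k : locally_integrable (open_itv l) (e k).
Proof. exact: cont_on_locint. Qed.

(** The pair [(e k, - k * e k)], first and second derivative of [- e k / k], has zero defect by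
    [exp_identity]. Splitting off the initial value 1 of [e k] gives the relation. *)
Lemma defect_exp k x : 0 < k -> `|x| < l ->
  defect x (fun=> 1) (fun=> 0) = k * defect0 x (e k).
Proof.
move=> k0 xl; apply/eqP; rewrite -subr_eq0 -mulNr -defect0Z//.
have prim t : `|t| < l -> oint 0 t (fun s => - k * e k s) = e k t - 1.
  move=> tl; have ck : cont_on l (fun s => - k * e k s) by exact: cont_onZ.
  rewrite (oint_FTC2 (fun x _ => e_is_derive k x) ck o0 tl).
  by rewrite /e mulr0 expR0.
rewrite -defectD//; [|exact: cont_on_cst|exact/oint_cont/o0/locintZ/e_locint
  |exact: locint_cst|exact/locintZ/e_locint].
rewrite (@eq_defect x _ (e k) _ (fun t => - k * e k t)); last 2 first.
- by move=> t tx; rewrite prim ?(le_lt_trans tx)//; ring.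
- by move=> t tx; rewrite add0r.
have eI := prim x xl; rewrite (ointZ _ (e_locint k) o0 xl) in eI.
have E := exp_identity k0 xl.
have -> : defect x (e k) (fun t => - k * e k t) = c * oint 0 x (e k) - tint K (e k) x -
    oint 0 x (fun s => alpha s *
    (c * expR (- k * s) + k * tint K' (fun t => expR (- k * t)) s)).
  congr (_ - _); apply: (@eq_oint _ `|x|); rewrite ?normr0// => t tx.
  have tl := le_lt_trans tx xl.
  by rewrite (tintZ _ cK' (e_locint k) tl) mulNr opprK.
move: E eI; rewrite -/(e k x) -/(e k).
move: (oint 0 x (e k)) (tint K (e k) x) (oint 0 x _) (e k x) => I T J y E eI.
(* [eI] rewrites [c * (y - 1)] as [- k * c * I]; the identity [E] then carries a common factor
   [k]. *)
have : - k * (c * I - T - J) = 0.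
  have := congr1 ( *%R c) eI => eI'; lra.
by move/eqP; rewrite mulf_eq0 oppr_eq0 (gt_eqF k0).
Qed.

(** In [defect_exp] the left side does not depend on [k], while [defect0 x (e k)] stays bounded for
    [k <= 1]; so the right side tends to 0 with [k]. *)
Lemma defect_lin x : `|x| < l -> defect x (fun=> 1) (fun=> 0) = 0.
Proof.
move=> xl; pose r := (`|x| + l) / 2.
have [xr rl] : `|x| <= r /\ r < l by split; rewrite /r; lra.
have r0 : 0 <= r by exact: le_trans xr.
have [C C0 dC] := defect0_le xr rl.
pose B := C * (expR r * (2 * r)).
have H k : 0 < k -> k <= 1 -> `|defect x (fun=> 1) (fun=> 0)| <= k * B.
  move=> k0 k1; rewrite (defect_exp k0 xl) normrM gtr0_norm//.
  rewrite ler_wpM2l ?(ltW k0)// (le_trans (dC _ (e_locint k)))// ler_wpM2l//.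
  apply: Rint_le_cst => //; first exact: (locint_cc (e_locint k) rl).
  move=> t tr; rewrite /e ger0_norm ?expR_ge0// ler_expR.
  move: tr; rewrite ler_norml => /andP[? ?]; nra.
have B0 : 0 <= B.
  apply: mulr_ge0 => //; apply: mulr_ge0; first exact: expR_ge0.
  by rewrite mulr_ge0.
apply/eqP; rewrite -normr_le0; apply/ler_addgt0Pr => d d0; rewrite add0r.
(* The bound is used at [k] = min(1, d / (B + 1)), where [k * B <= d]. *)
have [|] := leP 1 (d / (B + 1)) => kd.
  apply: (le_trans (H 1 ltr01 (lexx 1))); rewrite mul1r.
  by move: kd; rewrite ler_pdivlMr; lra.
apply: (le_trans (H _ _ (ltW kd))); first by rewrite divr_gt0// ltr_wpDl.
by rewrite mulrAC ler_pdivrMr ?ltr_wpDl// ler_wpM2l ?(ltW d0)//; lra.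
Qed.

Lemma defect0_exp k x : 0 < k -> `|x| < l -> defect0 x (e k) = 0.
Proof.
move=> k0 xl; have := defect_exp k0 xl; rewrite defect_lin// => /esym/eqP.
by rewrite mulf_eq0 (gt_eqF k0) => /eqP.
Qed.

Let bern_locint n phi k r :
  locally_integrable (open_itv l)
    (fun t => e k t * bern n phi (expR (- (t + r)))).
Proof.
apply: cont_on_locint; apply: cont_onM; first exact: e_cont.
move=> t _.
apply: (@continuous_comp _ _ _ (fun t => expR (- (t + r))) (bern n phi)).
  apply: (@continuous_comp _ _ _ (fun t => - (t + r)) expR).
    by apply: cvgN; apply: cvgD; [exact: cvg_id|exact: cvg_cst].
  exact: continuous_expR.
exact: bern_continuous.
Qed.

(** A factor [expR (- (t + r))] turns [e k] into [expR (- r) * e (k + 1)], so the induction on [n]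
    must quantify over all [k > 0]. *)
Lemma defect0_bern n phi k r x : 0 < k -> `|x| < l ->
  defect0 x (fun t => e k t * bern n phi (expR (- (t + r)))) = 0.
Proof.
move=> k0 xl.
elim: n phi k k0 => [|n IH] phi k k0 /=.
  rewrite (@eq_defect0 _ _ (fun t => phi 0%N * e k t)) => [|t _].
    2: by rewrite mulrC.
  by rewrite defect0Z// defect0_exp// mulr0.
have k10 : 0 < k + 1 by lra.
rewrite (@eq_defect0 _ _ (fun t =>
  expR (- r) * (e (k + 1) t * bern n (fun j => phi j.+1) (expR (- (t + r)))) +
  (e k t * bern n phi (expR (- (t + r))) +
   - expR (- r) * (e (k + 1) t * bern n phi (expR (- (t + r))))))); last first.
  move=> t _; have -> : e (k + 1) t = e k t * expR (- t).
    by rewrite /e -expRD; congr expR; ring.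
  have -> : expR (- (t + r)) = expR (- t) * expR (- r).
    by rewrite -expRD; congr expR; ring.
  by ring.
rewrite defect0D//; first last.
- by apply: locally_integrableD => //; exact: locintZ.
- exact: locintZ.
rewrite defect0D//; last exact: locintZ.
by rewrite !defect0Z// !IH// !mulr0 !addr0.
Qed.

(** The substitution [y = expR (- (t + r))] maps [- r, r] onto [q, 1], inside the domain of
    Bernstein approximation. The function approximated is [w / y]: multiplying back by [y] leaves
    only exponentials with [k >= 1]. *)
Lemma defect0_cont w x : continuous w -> `|x| < l -> defect0 x w = 0.
Proof.
move=> cw xl; pose r := (`|x| + l) / 2.
have [xr rl] : `|x| <= r /\ r < l by split; rewrite /r; lra.
have r0 : 0 < r by rewrite /r; have := normr_ge0 x; lra.
have [C C0 dC] := defect0_le xr rl.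
have wl : locally_integrable (open_itv l) w by apply: cont_on_locint => t _; exact: cw.
pose q : R := expR (- (2 * r)).
have q0 : 0 < q by exact: expR_gt0.
(* Truncation at [q] makes [f] continuous on the whole line and changes nothing on [q, 1]. *)
pose m y : R := Num.max y q.
have m0 y : 0 < m y by rewrite lt_max q0 orbT.
pose f y := w (- ln (m y) - r) / m y.
have cm : continuous m.
  move=> y.
  exact: (@continuous_max _ _ id (fun=> q) y (@cvg_id _ _) (@cvg_cst _ _ _ _ _)).
have cf : continuous f.
  move=> y; apply: cvgM; last by apply: cvgV; [rewrite gt_eqF|exact: cm].
  apply: (@continuous_comp _ _ _ (fun y => - ln (m y) - r) w); last exact: cw.
  apply: cvgB; last exact: cvg_cst.
  apply: cvgN; have : {for y, continuous (@ln R \o m)}.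
    by apply: continuous_comp; [exact: cm|exact: continuous_ln].
  by [].
have B0 : 0 <= C * (2 * r) by apply: mulr_ge0 => //; lra.
apply/eqP; rewrite -normr_le0; apply/ler_addgt0Pr => d d0; rewrite add0r.
have d'0 : 0 < d / (C * (2 * r) + 1) by rewrite divr_gt0// ltr_wpDl.
have [n fn] := bern_approx cf d'0.
set phi := (fun k : nat => _) in fn.
pose b t := expR (- r) * (e 1 t * bern n phi (expR (- (t + r)))).
have bl : locally_integrable (open_itv l) b by exact: locintZ.
have b0 : defect0 x b = 0 by rewrite /b defect0Z// defect0_bern ?mulr0.
have wb t : `|t| <= r -> `|w t + -1 * b t| <= d / (C * (2 * r) + 1).
  rewrite ler_norml => /andP[t1 t2].
  set y := expR (- (t + r)).
  have y0 : 0 < y by exact: expR_gt0.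
  have y1 : y <= 1 by rewrite -expR0 ler_expR; lra.
  have my : m y = y by rewrite /m; apply/max_idPl; rewrite ler_expR; lra.
  have -> : w t + -1 * b t = y * (f y - bern n phi y).
    have fy : f y = w t / y.
      by rewrite /f my /y expRK; congr (w _ / _); ring.
    have yE : expR (- r) * e 1 t = y by rewrite /e -expRD; congr expR; ring.
    by rewrite fy /b mulrA yE -/y; field; rewrite gt_eqF.
  rewrite normrM gtr0_norm//; have := fn y; rewrite (ltW y0) y1 => /(_ isT) fny.
  by rewrite -[leRHS]mul1r ler_pM// ltW.
have -> : defect0 x w = defect0 x (fun t => w t + -1 * b t).
  by rewrite (defect0D xl wl (locintZ (-1) bl)) (defect0Z _ xl bl) b0 mulr0 addr0.
have wbl : locally_integrable (open_itv l) (fun t => w t + -1 * b t).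
  by apply: locally_integrableD => //; exact: (locintZ (-1) bl).
apply: le_trans (dC _ wbl) _.
apply: (@le_trans _ _ (C * (d / (C * (2 * r) + 1) * (2 * r)))).
  by rewrite ler_wpM2l//; apply: Rint_le_cst; [exact: ltW|exact: (locint_cc wbl rl)|].
have -> : C * (d / (C * (2 * r) + 1) * (2 * r)) =
    d * ((C * (2 * r)) / (C * (2 * r) + 1)) by ring.
by rewrite ler_piMr ?(ltW d0)// ler_pdivrMr ?ltr_wpDl//; lra.
Qed.

(** Continuous functions are dense in L^1 of [- r, r], and [defect0_le] passes to the limit. *)
Lemma defect0_eq0 w x : locally_integrable (open_itv l) w -> `|x| < l ->
  defect0 x w = 0.
Proof.
move=> wl xl; pose r := (`|x| + l) / 2.
have [xr rl] : `|x| <= r /\ r < l by split; rewrite /r; lra.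
have [C C0 dC] := defect0_le xr rl.
have [||| g [cg ig gw]] := @approximation_continuous_integrable R `[- r, r] w.
- exact: measurable_itv.
- by rewrite /= lebesgue_measure_itv/=; case: ifPn => _; rewrite ltry.
- exact: (locint_cc wl rl).
have gl n : locally_integrable (open_itv l) (g n).
  by apply: cont_on_locint => t _; exact: cg.
have D n : `|defect0 x w| <= C * \int[mu]_(t in `[- r, r]) `|w t - g n t|.
  have -> : defect0 x w = defect0 x (fun t => w t + -1 * g n t).
    rewrite (defect0D xl wl (locintZ (-1) (gl n))) (defect0Z _ xl (gl n)).
    by rewrite (defect0_cont (cg n))// mulr0 addr0.
  have wgl : locally_integrable (open_itv l) (fun t => w t + -1 * g n t).
    by apply: locally_integrableD => //; exact: locintZ.
  apply: le_trans (dC _ wgl) _; rewrite le_eqVlt; apply/orP; left; apply/eqP.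
  by congr (_ * _); apply: eq_Rintegral => t _; rewrite mulN1r.
apply/eqP; rewrite -normr_le0.
have L : C * \int[mu]_(t in `[- r, r]) `|w t - g n t| @[n --> \oo] --> C * 0.
  apply: cvgM; first exact: cvg_cst.
  by move/fine_cvgP : gw => [_].
rewrite mulr0 in L; rewrite -(cvg_lim (@Rhausdorff R) L).
by apply: limr_ge; [exact: cvgP L|exact: nearW].
Qed.

Lemma transmutation_identity v0 w x : locally_integrable (open_itv l) w ->
  `|x| < l -> defect x (fun t => v0 + oint 0 t w) w = 0.
Proof.
move=> wl xl.
rewrite (@eq_defect x _ (fun t => v0 * 1 + oint 0 t w)
  _ (fun t => v0 * 0 + w t)); last 2 first.
- by move=> t _; rewrite mulr1.
- by move=> t _; rewrite mulr0 add0r.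
rewrite defectD//; [|exact/cont_onZ/cont_on_cst|exact: oint_cont
  |exact/locintZ/locint_cst].
rewrite defectZ ?defect_lin ?mulr0 ?add0r//; [|exact: cont_on_cst|exact: locint_cst].
exact: defect0_eq0.
Qed.

End Defect.
End Transmutation.

(** * Real and imaginary parts *)

Section RealForm.
Context {R : realType}.
Local Notation mu := (@lebesgue_measure R).
Implicit Types (f g h u v w : R -> R) (x y r l k : R) (K : R * R -> R).

Lemma eq_locint (D : set R) f g : measurable D -> (forall x, D x -> f x = g x) ->
  locally_integrable D f -> locally_integrable D g.
Proof.
move=> mD fg [mf oD foo]; split => //.
  by apply: eq_measurable_fun mf => x /set_mem; exact: fg.
move=> K KD cK; have := foo K KD cK; apply: le_lt_trans.
rewrite le_eqVlt; apply/orP; left; apply/eqP.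
by apply: eq_integral => x /set_mem/KD Dx; rewrite fg.
Qed.

Lemma eq_weak_derivative (D : set R) u1 u2 g1 g2 : measurable D ->
  (forall x, D x -> u1 x = u2 x) -> (forall x, D x -> g1 x = g2 x) ->
  weak_derivative D u1 g1 -> weak_derivative D u2 g2.
Proof.
move=> mD u12 g12 [lu lg ug]; split; [exact: eq_locint lu|exact: eq_locint lg|].
move=> phi tphi; transitivity (\int[mu]_(x in D) (u1 x * 'D_1 phi x)).
  by apply: eq_Rintegral => x /set_mem Dx; rewrite u12.
rewrite ug//; congr (- _); apply: eq_Rintegral => x /set_mem Dx.
by rewrite g12.
Qed.

(** One real component of the identity. [K], [K'] are the real parts of the kernels and [H], [H']
    the imaginary parts; [v2], [w2] are the derivatives of the other component of the function. The
    sign [s] is that of the cross term in a complex product: -1 for the real component, 1 for the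
    imaginary one. *)
Lemma weak_derivative_transmutation l alpha (K K' H H' : R * R -> R) (s : R)
    u v w v2 w2 : 0 < l -> cont_on l alpha ->
  cont2_on l K -> cont2_on l K' -> cont2_on l H -> cont2_on l H' ->
  (forall (v0 : R) w x, locally_integrable (open_itv l) w -> `|x| < l ->
     defect alpha 1 K K' x (fun t => v0 + oint 0 t w) w = 0) ->
  (forall (v0 : R) w x, locally_integrable (open_itv l) w -> `|x| < l ->
     defect alpha 0 H H' x (fun t => v0 + oint 0 t w) w = 0) ->
  weak_derivative (open_itv l) u v -> weak_derivative (open_itv l) v w ->
  weak_derivative (open_itv l) v2 w2 ->
  weak_derivative (open_itv l)
    (fun x => u x - (tint K v x + s * tint H v2 x))
    (fun x => alpha x * (v x - (tint K' w x + s * tint H' w2 x))).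
Proof.
move=> l0 ca cK cK' cH cH' dK dH uv vw vw2.
have [ul vl _] := uv; have [_ wl _] := vw; have [v2l w2l _] := vw2.
have o0 : `|0 : R| < l by rewrite normr0.
apply: weak_derivative_of_primitive => //.
- apply: locally_integrableB => //; apply: cont_on_locint.
  by apply: cont_onD; [exact: tint_cont|apply: cont_onZ; exact: tint_cont].
- apply: cont_on_mul_locint => //; apply: locally_integrableB => //.
  apply: cont_on_locint.
  by apply: cont_onD; [exact: tint_cont|apply: cont_onZ; exact: tint_cont].
move=> r r0 rl.
have [cu uE] := weak_derivative_primitive uv rl.
have [cv vE] := weak_derivative_primitive vw rl.
have [cv2 v2E] := weak_derivative_primitive vw2 rl.
(* Continuous versions of [v] and [v2] on the ball of radius [r]; the defects vanish for these. *)
pose V t := cv + oint 0 t w; pose V2 t := cv2 + oint 0 t w2.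
have cV : cont_on l V by apply: cont_onD; [exact: cont_on_cst|exact: oint_cont].
have cV2 : cont_on l V2 by apply: cont_onD; [exact: cont_on_cst|exact: oint_cont].
have ct := tint_cont cK' wl; have ct2 := tint_cont cH' w2l.
have c1 : cont_on l (fun t => alpha t * (1 * V t - tint K' w t)).
  by apply: cont_onM => //; apply: cont_onB => //; exact: cont_onZ.
have c2 : cont_on l (fun t => alpha t * (0 * V2 t - tint H' w2 t)).
  by apply: cont_onM => //; apply: cont_onB => //; exact: cont_onZ.
exists cu; exists (fun x => alpha x * (V x - (tint K' w x + s * tint H' w2 x))).
  apply: cont_onM => //; apply: cont_onB => //; apply: cont_onD => //.
  exact: cont_onZ.
have aeV : {ae mu, forall t, `|t| < r -> v t = V t} by exact: vE.
have aeV2 : {ae mu, forall t, `|t| < r -> v2 t = V2 t} by exact: v2E.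
move: uE vE; apply: filterS2; first exact: (ae_filter_ringOfSetsType mu).
move=> x ux vx xr; have xl := lt_trans xr rl.
have Nxr : `|- x| < r by rewrite normrN.
have o0r : `|0 : R| < r by rewrite normr0.
split; last by rewrite vx.
rewrite ux// (ae_eq_oint vl (cont_on_locint cV) rl aeV o0r xr).
have -> : tint K v x = tint K V x.
  apply: (ae_eq_oint _ _ rl _ Nxr xr); [exact: tint_locint| |].
    by apply: tint_locint => //; exact: cont_on_locint.
  move: aeV; apply: filterS; first exact: (ae_filter_ringOfSetsType mu).
  by move=> t + tr => /(_ tr) ->.
have -> : tint H v2 x = tint H V2 x.
  apply: (ae_eq_oint _ _ rl _ Nxr xr); [exact: tint_locint| |].
    by apply: tint_locint => //; exact: cont_on_locint.
  move: aeV2; apply: filterS; first exact: (ae_filter_ringOfSetsType mu).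
  by move=> t + tr => /(_ tr) ->.
have -> : oint 0 x (fun x => alpha x * (V x - (tint K' w x + s * tint H' w2 x))) =
    oint 0 x (fun t => alpha t * (1 * V t - tint K' w t)) +
    s * oint 0 x (fun t => alpha t * (0 * V2 t - tint H' w2 t)).
  rewrite -(ointZ s (cont_on_locint c2) o0 xl).
  rewrite -(ointD (cont_on_locint c1) (locintZ s (cont_on_locint c2)) o0 xl).
  apply: (@eq_oint _ `|x|); rewrite ?normr0// => t _.
  by move: (tint K' w t) (tint H' w2 t) (V t) (V2 t) => *; ring.
have := dH cv2 w2 x w2l xl; have := dK cv w x wl xl; rewrite /defect -/V -/V2.
move: (oint 0 x V) (oint 0 x V2) (tint K V x) (tint H V2 x).
set A := oint 0 x _; set B := oint 0 x _; move: A B => A B a b t q E1 E2.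
have -> : A = 1 * a - t by lra.
have -> : B = - q by lra.
by ring.
Qed.

End RealForm.

Section ComplexForm.
Context {R : realType}.
Local Notation mu := (@lebesgue_measure R).
Local Open Scope complex_scope.
Implicit Types (x y r l k : R) (K : R * R -> R[i]) (P : R[i] -> R).

(** One argument serves both parts; [P 1], which is 1 or 0, becomes the constant [c] of [defect]. *)
Definition is_part P := P = complex.Re (R := R) \/ P = complex.Im (R := R).

Lemma partZ P x z : is_part P -> P (x%:C * z) = x * P z.
Proof. by case=> ->; case: z => a b /=; rewrite mul0r ?subr0 ?addr0. Qed.

Lemma partB P z1 z2 : is_part P -> P (z1 - z2) = P z1 - P z2.
Proof. by case=> ->; case: z1 z2 => a b [c d]. Qed.

Lemma part_real P x : is_part P -> P x%:C = x * P 1.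
Proof. by move=> hP; rewrite -partZ// mulr1. Qed.

Lemma part_oriented_integral P x y (f : R -> R[i]) : is_part P ->
  P (oriented_integral x y f) = oint x y (fun t => P (f t)).
Proof.
rewrite /oriented_integral /cintegral => -[] ->; case: ifPn => [xy|].
- by rewrite oint_leE.
- by rewrite -ltNge => /ltW yx; rewrite oint_swap oint_leE.
- by rewrite oint_leE.
- by rewrite -ltNge => /ltW yx; rewrite oint_swap oint_leE.
Qed.

Lemma part_weak_derivative P (D : set R) (u g : R -> R[i]) : is_part P ->
  weak_derivativeC D u g -> weak_derivative D (fun x => P (u x)) (fun x => P (g x)).
Proof. by case=> -> []. Qed.

Lemma part_continuous P (V : topologicalType) (D : set V) (f : V -> R[i]) :
  is_part P -> continuousC D f -> {within D, continuous (fun z => P (f z))}.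
Proof. by case=> -> []. Qed.

Lemma within_cont_on l (D : set R) (f : R -> R) : open_itv l `<=` D ->
  {within D, continuous f} -> cont_on l f.
Proof.
move=> lD /(continuous_subspaceW lD); rewrite continuous_open_subspace; last first.
  exact: open_open_itv.
by move=> cf x xl; apply: cf; rewrite inE open_itvE.
Qed.

Lemma open_closed_itv l : open_itv l `<=` closed_itv l.
Proof.
move=> x; rewrite /open_itv /closed_itv /= !in_itv/=.
by move=> /andP[/ltW -> /ltW ->].
Qed.

Lemma closed_itvP l x : `|x| < l -> closed_itv l x.
Proof. by move=> xl; apply: open_closed_itv; rewrite open_itvE. Qed.

Lemma part_cont2 P l K : is_part P ->
  continuousC (closed_itv l `*` closed_itv l) K -> cont2_on l (fun z => P (K z)).
Proof.
move=> hP /(part_continuous hP).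
have sub : open_itv l `*` open_itv l `<=` closed_itv l `*` closed_itv l.
  by move=> z [z1 z2]; split; exact: open_closed_itv.
move=> /(continuous_subspaceW sub); rewrite continuous_open_subspace; last first.
  apply: openI; apply: open_comp; try exact: open_open_itv.
    by move=> z _; exact: cvg_fst.
  by move=> z _; exact: cvg_snd.
by move=> cK x t xl tl; apply: cK; rewrite inE; split; rewrite /= open_itvE.
Qed.

Lemma cexp_real x : cexp x%:C = (expR x)%:C.
Proof.
by apply/eqP; rewrite /cexp eq_complex /= cos0 sin0; apply/andP; split; apply/eqP; ring.
Qed.

(** At rho = i k all coefficients are real, so each part of e_a and of a^2 e_a' satisfies the same
    system; only the initial values, multiples of [P 1], differ. *)
Lemma kernel_system P l (a : R -> R) K k : is_part P -> 0 < l ->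
  cont_on l a -> (forall x, `|x| < l -> a x != 0) ->
  transmutation_kernel l a K -> 0 < k ->
  exists e z : R -> R, [/\ cont_on l e, cont_on l z,
    forall x, `|x| < l -> e x = P 1 + oint 0 x (fun t => a t ^- 2 * z t),
    forall x, `|x| < l ->
      z x = - (k * P 1) + oint 0 x (fun t => k ^+ 2 * (a t ^+ 2 * e t)) &
    forall x, `|x| < l -> e x = P 1 * expR (- k * x) +
      k * tint (fun z => P (K z)) (fun t => expR (- k * t)) x].
Proof.
move=> hP l0 ca aN0 [[_ cK] hexp _ _] k0.
have rhoE : 'i%C * (0 +i* k) = (- k)%:C.
  by apply/eqP; rewrite eq_complex /=; apply/andP; split; apply/eqP; ring.
have rho2E : (0 +i* k) ^+ 2 = (- (k ^+ 2))%:C.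
  apply/eqP; rewrite expr2 eq_complex /=.
  by apply/andP; split; apply/eqP; ring.
have [e [ce e0 [z [z' [[e' ee' zE] cz z0 zz' z'E]]]] eK] := hexp (0 +i* k).
have ce1 : cont_on l (fun x => P (e x)).
  exact: within_cont_on (@open_closed_itv l) (part_continuous hP ce).
have cz1 : cont_on l (fun x => P (z x)).
  exact: within_cont_on (@subset_refl _ _) (part_continuous hP cz).
have ca2 : cont_on l (fun x => a x ^+ 2) by apply: cont_onM.
have caV : cont_on l (fun x => a x ^- 2).
  by move=> x xl; apply: cvgV; [rewrite expf_neq0// aN0|exact: ca2].
exists (fun x => P (e x)), (fun x => P (z x)); split => // x xl.
- rewrite -[in RHS]e0; move: x xl.
  apply: (weak_derivative_cont l0 (part_weak_derivative hP ee') ce1 (cont_onM caV cz1)).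
  move: zE; apply: filterS; first exact: (ae_filter_ringOfSetsType mu).
  move=> x + xl; rewrite open_itvE => /(_ xl) <-.
  by rewrite -rmorphXn/= partZ// mulKf// expf_neq0// aN0.
- have -> : - (k * P 1) = P (z 0) by rewrite z0 rhoE part_real// mulNr.
  move: x xl.
  apply: (weak_derivative_cont l0 (part_weak_derivative hP zz') cz1).
    by apply: cont_onZ; apply: cont_onM.
  move: z'E; apply: filterS; first exact: (ae_filter_ringOfSetsType mu).
  move=> x + xl; rewrite open_itvE => /(_ xl).
  rewrite rho2E -rmorphXn -fmorphV/= => /(congr1 P).
  rewrite -mulNr -rmorphN/= !partZ// => E.
  have a20 : a x ^+ 2 != 0 by rewrite expf_neq0// aN0.
  have -> : P (z' x) = - (a x ^+ 2 * (- a x ^- 2 * P (z' x))).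
    by field; rewrite aN0.
  by rewrite E; ring.
- rewrite eK; last exact: closed_itvP.
  rewrite rhoE -rmorphM/= cexp_real partB// part_real// [P 1 * _]mulrC.
  rewrite partZ// [X in _ - X = _]mulNr opprK; congr (_ + _ * _).
  rewrite part_oriented_integral//; apply: (@eq_oint _ `|x|); rewrite ?normrN// => t _.
  by rewrite -rmorphM/= cexp_real mulrC partZ// mulrC.
Qed.

(* The spectral parameters i k with k > 0 suffice, and for these e^{i rho x} is
   real. The companion function a^2 e_a' equals - k e_{1/a}. *)
Lemma kernel_exp_identity P l (a : R -> R) K K' k x : is_part P -> 0 < l ->
  cont_on l a -> (forall x, `|x| < l -> a x != 0) ->
  transmutation_kernel l a K -> transmutation_kernel l (fun x => (a x)^-1) K' ->
  0 < k -> `|x| < l ->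
  P 1 * expR (- k * x) + k * tint (fun z => P (K z)) (fun t => expR (- k * t)) x =
  P 1 - k * oint 0 x (fun s => a s ^- 2 *
    (P 1 * expR (- k * s) + k * tint (fun z => P (K' z)) (fun t => expR (- k * t)) s)).
Proof.
move=> hP l0 ca aN0 iK iK' k0 xl.
have caV1 : cont_on l (fun x => (a x)^-1).
  by move=> y yl; apply: cvgV; [exact: aN0|exact: ca].
have aVN0 y : `|y| < l -> (a y)^-1 != 0 by move=> yl; rewrite invr_neq0// aN0.
have [e [z [ce cz eE zE eK]]] := kernel_system hP l0 ca aN0 iK k0.
have [e' [z' [ce' cz' e'E z'E e'K]]] := kernel_system hP l0 caV1 aVN0 iK' k0.
have ca2 : cont_on l (fun x => a x ^+ 2) by apply: cont_onM.
have caV : cont_on l (fun x => a x ^- 2).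
  move=> y yl; apply: cvgV; last exact: ca2.
  by rewrite expf_neq0// aN0.
rewrite -eK//.
rewrite (@dual_system _ l _ _ e z e' z' k (P 1) l0 k0 caV ca2 ce cz ce' cz' eE zE)//.
- congr (_ - _ * _); apply: (@eq_oint _ `|x|); rewrite ?normr0// => t tx.
  by rewrite e'K// (le_lt_trans tx).
(* For the impedance 1/a the weights a^-2 and a^2 trade places. *)
- move=> y yl; rewrite e'E//; congr (_ + _).
  by apply: (@eq_oint _ `|y|); rewrite ?normr0// => t _; rewrite exprVn invrK.
- move=> y yl; rewrite z'E//; congr (_ + _).
  by apply: (@eq_oint _ `|y|); rewrite ?normr0// => t _; rewrite exprVn.
Qed.

Lemma Re_kernel_integral l K (f : R -> R[i]) x :
  cont2_on l (fun z => complex.Re (K z)) -> cont2_on l (fun z => complex.Im (K z)) ->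
  locally_integrable (open_itv l) (fun t => complex.Re (f t)) ->
  locally_integrable (open_itv l) (fun t => complex.Im (f t)) -> `|x| < l ->
  complex.Re (oriented_integral (- x) x (fun t => K (x, t) * f t)) =
  tint (fun z => complex.Re (K z)) (fun t => complex.Re (f t)) x +
  -1 * tint (fun z => complex.Im (K z)) (fun t => complex.Im (f t)) x.
Proof.
move=> c1 c2 f1 f2 xl; have Nxl : `|- x| < l by rewrite normrN.
have l1 := tint_locint c1 f1 xl; have l2 := tint_locint c2 f2 xl.
rewrite part_oriented_integral; last by left.
rewrite /tint -(ointZ (-1) l2 Nxl xl) -(ointD l1 (locintZ (-1) l2) Nxl xl).
congr oint; apply/funext => t; case: (K (x, t)) (f t) => p q [r s] /=; ring.
Qed.

Lemma Im_kernel_integral l K (f : R -> R[i]) x :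
  cont2_on l (fun z => complex.Re (K z)) -> cont2_on l (fun z => complex.Im (K z)) ->
  locally_integrable (open_itv l) (fun t => complex.Re (f t)) ->
  locally_integrable (open_itv l) (fun t => complex.Im (f t)) -> `|x| < l ->
  complex.Im (oriented_integral (- x) x (fun t => K (x, t) * f t)) =
  tint (fun z => complex.Re (K z)) (fun t => complex.Im (f t)) x +
  1 * tint (fun z => complex.Im (K z)) (fun t => complex.Re (f t)) x.
Proof.
move=> c1 c2 f1 f2 xl; have Nxl : `|- x| < l by rewrite normrN.
have l1 := tint_locint c1 f2 xl; have l2 := tint_locint c2 f1 xl.
rewrite part_oriented_integral; last by right.
rewrite mul1r /tint -(ointD l1 l2 Nxl xl).
congr oint; apply/funext => t; case: (K (x, t)) (f t) => p q [r s] /=; ring.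
Qed.

End ComplexForm.

Theorem theorem30 (R : realType) (l : R) (a : R -> R)
  (Ka Kinva : R * R -> R[i]) (p : R) (u u' u'' : R -> R[i])
  (hl : 0 < l)
  (ha : impedance l a)
  (hKa : transmutation_kernel l a Ka)
  (hKinva : transmutation_kernel l (fun x => (a x)^-1) Kinva)
  (hp : 1 <= p)
  (hu : sobolev (open_itv l) 2 p%:E u)
  (hu' : weak_derivativeC (open_itv l) u u')
  (hu'' : weak_derivativeC (open_itv l) u' u'') :
  is_Da l a (transmutation Ka u u') (transmutation Kinva u' u'').
Proof.
have [[_ ca'] apos _ _ _] := ha.
have ca : cont_on l a := within_cont_on (@open_closed_itv _ l) ca'.
have aN0 x : `|x| < l -> a x != 0.
  by move=> xl; rewrite gt_eqF// apos// open_itvE.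
have caV : cont_on l (fun x => a x ^- 2).
  move=> y yl; apply: cvgV; first by rewrite expf_neq0// aN0.
  by apply: cvgM; exact: ca.
have re : is_part (complex.Re (R := R)) by left.
have im : is_part (complex.Im (R := R)) by right.
have [[_ cKa] _ _ _] := hKa; have [[_ cKi] _ _ _] := hKinva.
have c1 := part_cont2 re cKa; have c2 := part_cont2 im cKa.
have c1' := part_cont2 re cKi; have c2' := part_cont2 im cKi.
have d1 (v0 : R) w x : locally_integrable (open_itv l) w -> `|x| < l ->
    defect (fun x => a x ^- 2) 1 (fun z => complex.Re (Ka z))
      (fun z => complex.Re (Kinva z)) x (fun t => v0 + oint 0 t w) w = 0.
  apply: transmutation_identity => // k y k0 yl.
  exact: (kernel_exp_identity re hl ca aN0 hKa hKinva k0 yl).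
have d2 (v0 : R) w x : locally_integrable (open_itv l) w -> `|x| < l ->
    defect (fun x => a x ^- 2) 0 (fun z => complex.Im (Ka z))
      (fun z => complex.Im (Kinva z)) x (fun t => v0 + oint 0 t w) w = 0.
  apply: transmutation_identity => // k y k0 yl.
  exact: (kernel_exp_identity im hl ca aN0 hKa hKinva k0 yl).
have [u1 u2] := hu'; have [v1 v2] := hu''.
have [_ u1l _] := u1; have [_ u2l _] := u2; have [_ v1l _] := v1; have [_ v2l _] := v2.
have mI : measurable (open_itv l) by exact: measurable_itv.
(* With this version of the weak derivative of T_a u, the equation in [is_Da] holds at every point
   of the interval. *)
exists (fun x => (a x ^- 2)%:C%C * transmutation Kinva u' u'' x); last first.
  apply: aeW => x; rewrite open_itvE => xl.
  rewrite rmorphV/=; last by rewrite unitfE expf_neq0// aN0.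
  rewrite rmorphXn/= mulVKf// expf_neq0//.
  by rewrite (fmorph_eq0 (real_complex R)) aN0.
split.
- apply: (eq_weak_derivative mI _ _ (weak_derivative_transmutation (-1) hl caV
    c1 c1' c2 c2' d1 d2 u1 v1 v2)) => x; rewrite open_itvE => xl.
  + by rewrite (partB _ _ re) (Re_kernel_integral c1 c2 u1l u2l xl).
  + by rewrite (partZ _ _ re) (partB _ _ re) (Re_kernel_integral c1' c2' v1l v2l xl).
- apply: (eq_weak_derivative mI _ _ (weak_derivative_transmutation 1 hl caV
    c1 c1' c2 c2' d1 d2 u2 v2 v1)) => x; rewrite open_itvE => xl.
  + by rewrite (partB _ _ im) (Im_kernel_integral c1 c2 u1l u2l xl).
  + by rewrite (partZ _ _ im) (partB _ _ im) (Im_kernel_integral c1' c2' v1l v2l xl).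
Qed.
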